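(* For any finite Galois extension $L/K$ of number fields, $$\zeta_{L/K}[\mathfrak{X}_K]=\zeta_K[\mathfrak{X}_K]\prod_{\rho\ne\mathbf{1}}\mathcal{L}(\mathfrak{X}_K,\rho;L/K)^{\dim(\rho)},$$ where $\rho\neq\mathbf{1}$ ranges over all equivalence classes of nontrivial irreducible complex representations of $\mathrm{Gal}(L/K)$.
   Context: For a number field $K$ with ring of integers $\mathcal{O}_K$: $\mathbb{P}_K$ is the set of (nonzero) prime ideals of $\mathcal{O}_K$ and $\mathcal{J}_K^+$ is the monoid of (nonzero) integral ideals. $\mathbb{Q}^{\mathrm{ab}}\subset\mathbb{C}$ is the maximal abelian extension of $\mathbb{Q}$ and $\Lambda$ is the ring of symmetric functions with coefficients in $\mathbb{Q}^{\mathrm{ab}}$. For each $\mathfrak{q}\in\mathbb{P}_K$ let $\mathfrak{X}^{(\mathfrak{q})}=x_1^{(\mathfrak{q})}+x_2^{(\mathfrak{q})}+\cdots$ be a set of commuting free variables, $\mathfrak{X}_K=(\mathfrak{X}^{(\mathfrak{q})})_{\mathfrak{q}}$, and let $A_K:=\bigotimes_{\mathfrak{q}\in\mathbb{P}_K}\Lambda[\mathfrak{X}^{(\mathfrak{q})}]$ (direct limit of tensor products over finite subsets of $\mathbb{P}_K$), graded by $\mathcal{J}_K^+$: an element homogeneous of degree $d_{\mathfrak{q}}$ in each $\mathfrak{X}^{(\mathfrak{q})}$ has degree $\prod_{\mathfrak{q}}\mathfrak{q}^{d_{\mathfrak{q}}}$. $\mathcal{A}_K$ is the completion of $A_K$: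 formal sums $\sum_{\mathfrak{a}\in\mathcal{J}_K^+}F_{\mathfrak{a}}$ with $F_{\mathfrak{a}}\in A_K$ of degree $\mathfrak{a}$, with the Cauchy product. Dedekind symmetric functions in $\mathcal{A}_K$: $\zeta_K[\mathfrak{X}_K]:=\prod_{\mathfrak{q}\in\mathbb{P}_K}\prod_{i\ge1}(1-x_i^{(\mathfrak{q})})^{-1}$ and $\zeta_{L/K}[\mathfrak{X}_K]:=\prod_{\mathfrak{q}\in\mathbb{P}_K}\prod_{\mathfrak{p}\in\mathbb{P}_L,\ \mathfrak{p}|\mathfrak{q}}\prod_{i\ge1}\left(1-(x_i^{(\mathfrak{q})})^{f(\mathfrak{p}|\mathfrak{q})}\right)^{-1}$, where $f(\mathfrak{p}|\mathfrak{q})=\dim_{\mathcal{O}_K/\mathfrak{q}}(\mathcal{O}_L/\mathfrak{p})$. Artin symmetric function: for $L/K$ finite Galois and $\rho:\mathrm{Gal}(L/K)\to\mathrm{GL}(V)$ a finite-dimensional complex representation, choose for each $\mathfrak{q}\in\mathbb{P}_K$ a prime $\mathfrak{p}\in\mathbb{P}_L$ over $\mathfrak{q}$; let $I(\mathfrak{q})\subset D(\mathfrak{q})\subset\mathrm{Gal}(L/K)$ be the inertia and decomposition groups of $\mathfrak{p}$ and $\sigma_{\mathfrak{q}}\in D(\mathfrak{q})/I(\mathfrak{q})$ the Frobenius element. With $V^{I(\mathfrak{q})}$ the $I(\mathfrak{q})$-fixed subspace, $\mathcal{L}(\mathfrak{X}_K,\rho;L/K):=\prod_{\mathfrak{q}\in\mathbb{P}_K}\prod_{i\ge1}\det\left(\mathrm{Id}_{V^{I(\mathfrak{q})}}-x_i^{(\mathfrak{q})}\rho(\sigma_{\mathfrak{q}})|_{V^{I(\mathfrak{q})}}\right)^{-1}\in\mathcal{A}_K$;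 this is independent of the choices of $\mathfrak{p}$. *)

(* Defs.v *)
From HB Require Import structures.
From mathcomp Require Import all_boot all_order all_algebra all_fingroup.
From mathcomp Require Import all_solvable all_field mxrepresentation.
From mathcomp Require Import generic_quotient ring_quotient.
From mathcomp Require Import finmap multiset.
From mathcomp Require Import boolp classical_sets functions cardinality fsbigop.
From mathcomp Require Import reals complex.

Set Implicit Arguments.
Unset Strict Implicit.
Unset Printing Implicit Defensive.

Import GRing.Theory.

Local Open Scope classical_set_scope.
Local Open Scope ring_scope.

Section RingOfIntegers.
Variable F : fieldType.

Definition integral_pred : {pred F} :=
  fun x => `[< integralOver (intr : int -> F) x >].

Fact integral_pred_subring : subring_closed integral_pred.
Proof.
split=> [|x y|x y]; rewrite /integral_pred ?unfold_in.
- by apply/asboolP; exact: integral1.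
- by move=> /asboolP ix /asboolP iy; apply/asboolP; exact: integral_sub.
- by move=> /asboolP ix /asboolP iy; apply/asboolP; exact: integral_mul.
Qed.

Record integers := Integers {
  integers_val :> F;
  integers_valP : integers_val \in integral_pred }.

HB.instance Definition _ := [isSub of integers for integers_val].
HB.instance Definition _ := [Choice of integers by <:].
HB.instance Definition _ :=
  GRing.SubChoice_isSubComNzRing.Build F integral_pred integers
    integral_pred_subring.

Definition nonzero_prime_ideal (S : {pred integers}) : Prop :=
  [/\ idealr_closed S, prime_idealr_closed S & exists2 x, x \in S & x != 0].

Record prime_ideal := PrimeIdeal {
  prime_ideal_pred :> integers -> bool;
  _ : `[< nonzero_prime_ideal prime_ideal_pred >] }.

Canonical prime_ideal_predType := PredType prime_ideal_pred.
HB.instance Definition _ := [isSub of prime_ideal for prime_ideal_pred].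
HB.instance Definition _ := [Choice of prime_ideal by <:].

Fact prime_idealP (p : prime_ideal) : nonzero_prime_ideal p.
Proof. by case: p => p /= /asboolP. Qed.

HB.instance Definition _ (p : prime_ideal) :=
  isIdealr.Build integers (prime_ideal_pred p) (let: And3 h _ _ := prime_idealP p in h).
HB.instance Definition _ (p : prime_ideal) :=
  isPrimeIdealrClosed.Build integers (prime_ideal_pred p)
    (let: And3 _ h _ := prime_idealP p in h).

Definition residue_field (p : prime_ideal) : Type :=
  {ideal_quot (Idealr.clone integers (prime_ideal_pred p) _)}.
HB.instance Definition _ p := GRing.ComNzRing.on (residue_field p).

Definition residue_card (p : prime_ideal) : nat :=
  #|` fset_set [set: residue_field p] |.

End RingOfIntegers.

Section Primes.
Variables (K : fieldType) (L : fieldExtType K).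

Fact in_alg_integral (x : integers K) : (integers_val x)%:A \in @integral_pred L.
Proof.
case: x => x /= /asboolP[p mon_p px0]; apply/asboolP; exists p => //.
have -> : map_poly intr p = map_poly (in_alg L) (map_poly intr p).
  by rewrite -map_poly_comp; apply: eq_map_poly => n; rewrite [RHS]rmorph_int.
by rewrite -in_algE rmorph_root.
Qed.

Definition integers_in_alg (x : integers K) : integers L :=
  Integers (in_alg_integral x).

(* p lies over q, i.e. p divides q O_L *)
Definition lies_over (p : prime_ideal L) (q : prime_ideal K) : Prop :=
  forall x : integers K, (integers_in_alg x \in p) = (x \in q).

(* The map O_K/q -> O_L/p induced by O_K -> O_L; independent of the chosen
   representative when p lies over q *)
Definition residue_map (p : prime_ideal L) (q : prime_ideal K)
    (x : residue_field q) : residue_field p :=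
  \pi_(residue_field p)%qT (integers_in_alg (generic_quotient.repr x)).

Definition residue_dim (p : prime_ideal L) (q : prime_ideal K) (n : nat) :=
  exists b : 'I_n -> residue_field p, forall y : residue_field p,
    exists! c : {ffun 'I_n -> residue_field q},
      y = \sum_(j < n) residue_map p (c j) * b j.

(* f(p|q) *)
Definition residue_degree (p : prime_ideal L) (q : prime_ideal K) : nat :=
  xget 0%N [set n | residue_dim p q n].

End Primes.

Section Frobenius.
Variables (K : fieldType) (L : splittingFieldType K).
Local Notation G := 'Gal({:L} / 1%AS)%g.

Fact gal_integral (s : gal_of {:L}) (x : integers L) :
  s (integers_val x) \in @integral_pred L.
Proof.
case: x => x /= /asboolP[p mon_p px0]; apply/asboolP; exists p => //.
have -> : map_poly intr p = map_poly s (map_poly intr p).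
  by rewrite -map_poly_comp; apply: eq_map_poly => n; rewrite [RHS]rmorph_int.
by rewrite rmorph_root.
Qed.

Definition gal_integers (s : gal_of {:L}) (x : integers L) : integers L :=
  Integers (gal_integral s x).

Definition decomposition_group (p : prime_ideal L) : {set gal_of {:L}} :=
  [set s in G | `[< forall x, (gal_integers s x \in p) = (x \in p) >]]%SET.

Definition inertia_group (p : prime_ideal L) : {set gal_of {:L}} :=
  [set s in decomposition_group p |
     `[< forall x, gal_integers s x - x \in p >]]%SET.

Definition is_frobenius (p : prime_ideal L) (q : prime_ideal K)
    (u : coset_of (inertia_group p)) : Prop :=
  forall (s : gal_of {:L}) (x : integers L), s \in (u : {set _}) ->
    gal_integers s x - x ^+ residue_card q \in p.

(* The default value 1 is only taken when there is no Frobenius element,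
   which cannot happen for number fields and p lying over q *)
Definition frobenius (p : prime_ideal L) (q : prime_ideal K) :
    coset_of (inertia_group p) :=
  odflt 1%g [pick u in (decomposition_group p / inertia_group p)%g
             | `[< is_frobenius q u >]].

End Frobenius.

Local Notation monomial V := (multiset_of (Phant V)).

Section FormalSeries.
Variables (V : choiceType) (R : comNzRingType).
Implicit Types m n : monomial V.

(* Formal power series over R in the (possibly infinitely many) commuting
   variables indexed by V; a monomial is the multiset of its variables *)
Definition fseries : Type := monomial V -> R.
Implicit Types f g h : fseries.

HB.instance Definition _ := GRing.Zmodule.copy fseries (monomial V -> R).

Definition fs_one : fseries := fun m => (m == mset0)%:R.

(* The sum is finite since a monomial has finitely many factorizations *)
Definition fs_mul f g : fseries := fun m =>
  \sum_(d \in [set d : monomial V * monomial V | (d.1 `+` d.2)%mset = m])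
    f d.1 * g d.2.

Lemma fs_addE f g m : (f + g) m = f m + g m. Proof. by []. Qed.

Lemma finite_msubset m : finite_set [set n | (n `<=` m)%mset].
Proof.
pose N := (\max_(x <- finsupp m) m x)%N.+1.
pose h (c : {ffun finsupp m -> 'I_N}) : monomial V :=
  [fsfun x : finsupp m => (c x : nat)].
apply: (@sub_finite_set _ _ (h @` setT)) => [n /= /msubsetP le_nm|];
  last exact/finite_image/finite_finset.
have ltN (x : finsupp m) : (n (val x) < N)%N.
  rewrite ltnS (leq_trans (le_nm _)) //.
  by apply: (@leq_bigmax_seq _ _ predT m) => //; apply: (valP x).
exists [ffun x => Ordinal (ltN x)] => //; apply/msetP => x.
rewrite /h fsfun_ffun; case: insubP => [y ym <-|xm] /=; first by rewrite ffunE.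
by apply/esym/eqP; rewrite -leqn0 (leq_trans (le_nm x)) // fsfun_dflt.
Qed.

Let D m := fset_set [set n | (n `<=` m)%mset].
Let inD m n : (n \in D m) = (n `<=` m)%mset.
Proof. by rewrite in_fset_set ?inE; [apply: asboolb | exact: finite_msubset]. Qed.

Lemma fs_mulE (B : {fset (monomial V)}) f g m :
    (forall n, (n `<=` m)%mset -> n \in B) ->
  fs_mul f g m = \sum_(x <- B) \sum_(y <- B | (x `+` y)%mset == m) f x * g y.
Proof.
move=> inB.
pose P : pred (monomial V * monomial V) := fun d => (d.1 `+` d.2)%mset == m.
have -> : fs_mul f g m =
    \sum_(d <- [seq (x, y) | x <- B, y <- B] | P d) f d.1 * g d.2.
  rewrite bigfs.
  - by apply: eq_fsbigl; apply/seteqP; split=> d /= /eqP.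
  - by rewrite allpairs_uniq// => -[? ?] [? ?].
  - move=> [x y] /eqP/= def_m; rewrite allpairs_f ?inB // -def_m.
      by apply/msubsetP => v; rewrite !msetE2 leq_addr.
    by apply/msubsetP => v; rewrite !msetE2 leq_addl.
by rewrite big_mkcond big_allpairs; apply: eq_bigr => x _; rewrite -big_mkcond.
Qed.

Lemma fs_mulC : commutative fs_mul.
Proof.
move=> f g; apply/funext => m; rewrite !(@fs_mulE (D m)) => [||n]; first last.
- by rewrite inD.
- by move=> n; rewrite inD.
under eq_bigr do rewrite big_mkcond; rewrite exchange_big /=.
apply: eq_bigr => x _; rewrite [RHS]big_mkcond; apply: eq_bigr => y _.
by rewrite msetDC mulrC.
Qed.

Lemma fs_mulDl : left_distributive fs_mul +%R.
Proof.
move=> f g h; apply/funext => m; rewrite fs_addE !(@fs_mulE (D m)); first last.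
- by move=> n; rewrite inD.
- by move=> n; rewrite inD.
- by move=> n; rewrite inD.
rewrite -big_split; apply: eq_bigr => x _; rewrite -big_split /=.
by apply: eq_bigr => y _; rewrite mulrDl.
Qed.

Lemma fs_mul1f : left_id fs_one fs_mul.
Proof.
move=> f; apply/funext => m; rewrite (@fs_mulE (D m)) => [|n]; last by rewrite inD.
have D0 : mset0 \in D m by rewrite inD multiset.msub0set.
have Dm : m \in D m by rewrite inD; exact/msubsetP.
rewrite (big_rem mset0) //= [X in _ + X]big1_seq ?addr0 => [|x]; last first.
  rewrite /= mem_rem_uniq ?fset_uniq // => /andP[x0 _].
  by rewrite big1 // => y _; rewrite /fs_one (negPf x0) mul0r.
rewrite (big_rem m) //= mset0D eqxx /fs_one eqxx mul1r.
rewrite big1_seq ?addr0 // => y /andP[/eqP <-].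
by rewrite mset0D mem_rem_uniq ?fset_uniq // inE eqxx.
Qed.

Lemma fs_mul3 f g h m : fs_mul (fs_mul f g) h m =
  \sum_(x <- D m) \sum_(y <- D m) \sum_(z <- D m)
    if (x `+` y `+` z)%mset == m then f x * g y * h z else 0.
Proof.
rewrite (@fs_mulE (D m)) => [|n]; last by rewrite inD.
transitivity (\sum_(a <- D m) \sum_(z <- D m) \sum_(x <- D m) \sum_(y <- D m)
    if ((x `+` y)%mset == a) && ((a `+` z)%mset == m) then f x * g y * h z else 0).
  apply: eq_big_seq => a; rewrite inD => le_am; rewrite big_mkcond.
  apply: eq_bigr => z _; case: eqP => _; last first.
    by symmetry; rewrite big1 // => x _; rewrite big1 // => y _; rewrite andbF.
  rewrite (@fs_mulE (D m)) => [|n /msubset_trans/(_ le_am)]; last by rewrite inD.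
  rewrite mulr_suml; apply: eq_bigr => x _; rewrite mulr_suml big_mkcond.
  by apply: eq_bigr => y _; rewrite andbT.
under eq_bigr => a _ do rewrite exchange_big.
rewrite exchange_big; apply: eq_bigr => x _ /=.
under eq_bigr => a _ do rewrite exchange_big.
rewrite exchange_big; apply: eq_bigr => y _ /=.
rewrite exchange_big; apply: eq_bigr => z _ /=.
case: eqP => [def_m|neq_m]; last first.
  by rewrite big1 // => a _; case: eqP => //= <-; case: eqP.
have Da : (x `+` y)%mset \in D m.
  by rewrite inD -def_m; apply/msubsetP => v; rewrite [X in (_ <= X)%N]msetE2 leq_addr.
rewrite (big_rem (x `+` y)%mset) //= eqxx def_m eqxx big1_seq ?addr0 // => a /=.
by rewrite mem_rem_uniq ?fset_uniq // !inE eq_sym => /andP[/negPf ->].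
Qed.

Lemma fs_mulA : associative fs_mul.
Proof.
move=> f g h; apply/funext => m; rewrite fs_mulC !fs_mul3.
under eq_bigr => x _ do rewrite exchange_big.
rewrite exchange_big; apply: eq_bigr => z _; apply: eq_bigr => x _.
apply: eq_bigr => y _ /=.
by rewrite [in LHS]msetDC msetDA [in LHS]mulrC mulrA.
Qed.

Lemma fs_one_neq0 : fs_one != 0 :> fseries.
Proof.
apply/eqP => /(congr1 (fun f : fseries => f mset0)).
by rewrite /fs_one eqxx => /eqP; rewrite oner_eq0.
Qed.

HB.instance Definition _ := GRing.Zmodule_isComNzRing.Build fseries
  fs_mulA fs_mulC fs_mul1f fs_mulDl fs_one_neq0.

Definition fs_unit : pred fseries := fun f => `[< exists g, g * f = 1 >].
Definition fs_inv f : fseries := xget f [set g | g * f = 1].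

Fact fs_mulVf : {in fs_unit, left_inverse 1 fs_inv *%R}.
Proof. by move=> f /asboolP ex_g; apply: (xgetPex f ex_g). Qed.

Fact fs_unitP f g : g * f = 1 -> fs_unit f.
Proof. by move=> gf1; apply/asboolP; exists g. Qed.

Fact fs_inv_out : {in [predC fs_unit], fs_inv =1 id}.
Proof.
move=> f; rewrite inE => /asboolP no_g.
by rewrite /fs_inv; case: xgetP => // g _ gf1; case: no_g; exists g.
Qed.

HB.instance Definition _ := GRing.ComNzRing_hasMulInverse.Build fseries
  fs_mulVf fs_unitP fs_inv_out.

Definition fs_const (c : R) : fseries := fun m => if m == mset0 then c else 0.

Definition fs_var (v : V) : fseries := fun m => (m == msetn 1 v)%:R.

(* The product of a family of series for coefficientwise convergence along the
   finite subfamilies, R being discrete: a coefficient of the product is the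
   common value of that coefficient in all the large enough finite subproducts.
   The default 0 is only taken by coefficients that do not stabilize *)
Definition fs_infprod (J : choiceType) (F : J -> fseries) : fseries := fun m =>
  xget 0 [set c | exists S0 : {fset J}, forall S : {fset J},
    (S0 `<=` S)%fset -> (\prod_(j <- S) F j) m = c].

End FormalSeries.

Arguments fs_const {V R} c.
Arguments fs_infprod {V R J} F.

Section CompletedRing.
Variables (R : realType) (K : fieldExtType rat).
Local Notation C := R[i].

(* The maximal abelian extension of Q in the complex numbers, as the union of
   the images of all the finite abelian extensions of Q *)
Definition Qab : set C := [set z |
  exists (E : splittingFieldType rat) (phi : {rmorphism E -> C}) (a : E),
    [/\ galois 1%AS {:E}, abelian 'Gal({:E} / 1%AS)%g & phi a = z]].

(* The variable x_i^(q) is indexed by (q, i), with i counted from 0 *)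
Definition sym_var : choiceType := (prime_ideal K * nat)%type.
Definition sym_X (q : prime_ideal K) (i : nat) : fseries sym_var C :=
  fs_var C ((q, i) : sym_var).

Definition same_orbit (m n : monomial sym_var) : Prop :=
  exists s : prime_ideal K -> nat -> nat,
    (forall q, bijective (s q)) /\ (forall q i, m (q, i) = n (q, s q i)).

(* The completion of A_K.  Assigning to a monomial its degrees d_q in the sets
   of variables X^(q) is the same as assigning to it the ideal \prod_q q^d_q,
   by unique factorization, and an element of A_K of degree \prod_q q^d_q is a
   formal sum of monomials of degrees (d_q)_q with coefficients in Q^ab that is
   symmetric in the variables of X^(q) for each q separately.  Hence a formal
   sum of such elements, one for each ideal, is a series in all the variables
   that is separately symmetric and has coefficients in Q^ab; the Cauchy
   product is the product of series *)
Definition completed_AK : set (fseries sym_var C) := [set f |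
  (forall m n, same_orbit m n -> f m = f n) /\ (forall m, Qab (f m))].

Definition zeta : fseries sym_var C :=
  fs_infprod (fun q => fs_infprod (fun i => (1 - sym_X q i)^-1)).

End CompletedRing.
Arguments sym_X R {K} q i.
Arguments completed_AK R K _ : clear implicits.
Arguments zeta R K _ : clear implicits.

Section RelativeZeta.
Variables (R : realType) (K : fieldExtType rat) (L : fieldExtType K).

Definition zeta_rel : fseries (sym_var K) R[i] :=
  fs_infprod (fun q =>
    \big[*%R/1]_(p \in [set p : prime_ideal L | lies_over p q])
      fs_infprod (fun i => (1 - sym_X R q i ^+ residue_degree p q)^-1)).

End RelativeZeta.
Arguments zeta_rel R {K} L _.

Section Artin.
Variables (R : realType) (K : fieldExtType rat) (L : splittingFieldType K).
Local Notation C := R[i].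
Local Notation G := 'Gal({:L} / 1%AS)%g.

Section Def.
Variables (n : nat) (rho : mx_representation C G n).
(* The chosen prime over each q *)
Variable P : prime_ideal K -> prime_ideal L.

(* rho(sigma_q) on V^I(q), which does not depend on the element representing
   the coset sigma_q.  Here V is the space of row vectors, on which s in G acts
   by right multiplication by rho s; since (s * t)%g is "s, then t" in G, this
   is a left action of the group of automorphisms for composition *)
Definition frobenius_mx (q : prime_ideal K) :
    'M[C]_(\rank (rfix_mx rho (inertia_group (P q)))) :=
  conjmx (row_base (rfix_mx rho (inertia_group (P q))))
    (rho (fingroup.repr (frobenius (P q) q))).

Definition artin : fseries (sym_var K) C :=
  fs_infprod (fun q => fs_infprod (fun i =>
    (\det (1%:M - sym_X R q i *: map_mx fs_const (frobenius_mx q)))^-1)).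

End Def.
End Artin.

Section Representations.
Variables (F : fieldType) (gT : finGroupType) (G : {group gT}).

Fact trivial_mx_repr : mx_repr G (fun _ : gT => 1%:M : 'M[F]_1).
Proof. by split=> // x y _ _; rewrite mulmx1. Qed.
Definition trivial_representation := MxRepresentation trivial_mx_repr.

(* (rho j)_j is a system of representatives of the equivalence classes of
   nontrivial irreducible representations of G *)
Definition nontrivial_irr_system (J : finType) (d : J -> nat)
    (rho : forall j, mx_representation F G (d j)) : Prop :=
  [/\ forall j, mx_irreducible (rho j) /\
                ~ mx_rsim (rho j) trivial_representation,
      forall j k, mx_rsim (rho j) (rho k) -> j = k
    & forall n (tau : mx_representation F G n), mx_irreducible tau ->
        ~ mx_rsim tau trivial_representation -> exists j, mx_rsim tau (rho j)].

End Representations.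

(* Main.v *)
(** Write X = x_i^(q).  For the chosen prime p over q, with decomposition group
    D, inertia group I and Frobenius s, the local identity at q is

      (1 - X^f)^g = (1 - X) \prod_(rho <> 1) det (1 - X rho(s) | V^I)^(dim rho),

    where g is the number of primes over q and f the common residue degree.
    Both sides are products of factors 1 - lambda X with lambda a root of unity
    of order dividing |G|, so it is enough to compare the power sums of the
    lambda.  Since the sum of rho over I is |I| times a projection onto V^I,
    |I| tr (s^t | V^I) is the sum of the character of rho over s^t I, and by
    the decomposition of the regular representation the t-th power sum of the
    right-hand side is |G| / |I| if s^t lies in I and 0 otherwise.  As D / I is
    cyclic of order f, generated by s, and |G| = g f |I|, this is also the t-th
    power sum of the left-hand side.

    The local identities are assembled in the ring of formal series through the
    explicit formula \prod_v a_v(m_v) for the coefficient at m of the product of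
    univariate series \sum_k a_v(k) x_v^k.  It is multiplicative in a, and it
    shows that the coefficients are symmetric and lie in the |G|-th cyclotomic
    field. *)
Require Import Defs.
From HB Require Import structures.
From mathcomp Require Import all_boot all_algebra all_fingroup.
From mathcomp Require Import all_solvable all_field mxrepresentation.
From mathcomp Require Import generic_quotient ring_quotient finmap multiset.
From mathcomp Require Import boolp classical_sets functions cardinality fsbigop.
From mathcomp Require Import reals complex.
From mathcomp Require integral_char.
Set Implicit Arguments.
Unset Strict Implicit.
Unset Printing Implicit Defensive.
Import GRing.Theory Num.Theory.
Local Notation monomial V := (multiset_of (Phant V)).

(** * Euler products of formal series *)

Section EulerSeries.
Local Open Scope ring_scope.
Variables (V : choiceType) (R : comNzRingType).
Implicit Types (a b : V -> nat -> R).

(** This is the product over all variables only if every [a v 0] is 1, a condition that reappears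
    below as [unitary]. *)
Definition eseries (a : V -> nat -> R) : fseries V R :=
  fun m => \prod_(v <- finsupp m) a v (m v).

Definition cauchy (a b : nat -> R) (k : nat) : R :=
  \sum_(i < k.+1) a i * b (k - i)%N.

(** A common bound N on both indices lets the convolutions of all variables be expanded over one
    space of exponent functions. *)
Lemma cauchy_widen (a b : nat -> R) k N : (k < N)%N ->
  cauchy a b k = \sum_(i < N) \sum_(j < N | (i + j == k)%N) a i * b j.
Proof.
move=> ltkN; rewrite /cauchy (big_ord_widen N (fun i => a i * b (k - i)%N)) //.
rewrite big_mkcond /=; apply: eq_bigr => i _; rewrite ltnS; case: leqP => [leik|ltki].
  have ltN : (k - i < N)%N by rewrite (leq_ltn_trans _ ltkN) ?leq_subr.
  rewrite (big_pred1 (Ordinal ltN)) // => j /=.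
  by rewrite -val_eqE /= -[RHS](eqn_add2l i) subnKC.
by rewrite big_pred0 // => j; apply/negbTE; rewrite gtn_eqF ?ltn_addr.
Qed.

Lemma eseries_fsub a (D : {fset V}) (m : monomial V) : (forall v, a v 0%N = 1) ->
  (finsupp m `<=` D)%fset -> eseries a m = \prod_(v : D) a (val v) (m (val v)).
Proof.
move=> a0 sub; rewrite /eseries (big_fset_incl _ sub) ?big_seq_fsetE // => v _.
by rewrite mem_finsupp negbK => /eqP ->.
Qed.

(** Distributivity turns the product of the convolutions into a sum over pairs of exponent functions
    on the support of m that add up to m; these are exactly the factorizations of m. *)
Lemma eseriesM a b : (forall v, a v 0%N = 1) -> (forall v, b v 0%N = 1) ->
  eseries a * eseries b = eseries (fun v => cauchy (a v) (b v)).
Proof.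
move=> a0 b0; apply/funext => m.
have c0 v : cauchy (a v) (b v) 0 = 1 by rewrite /cauchy big_ord1 a0 b0 mulr1.
rewrite [RHS](eseries_fsub c0 (fsubset_refl _)).
(* Every divisor of m is supported in [D] with exponents below [N], so it is [h c] for a unique
   [c]. *)
pose D := finsupp m; pose N := (\max_(x <- D) m x)%N.+1.
have ltN (v : D) : (m (val v) < N)%N.
  by rewrite ltnS (@leq_bigmax_seq _ _ predT m) //; apply: (valP v).
pose h (c : {ffun D -> 'I_N}) : monomial V := [fsfun x : D => (c x : nat)].
have hE c (v : D) : h c (val v) = c v by rewrite /h fsfun_ffun valK.
have h_out c v : v \notin D -> h c v = 0%N.
  by move=> vD; rewrite /h fsfun_ffun insubN.
have supp_h c : (finsupp (h c) `<=` D)%fset.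
  by apply/fsubsetP => v; rewrite mem_finsupp; apply: contraR => /h_out ->.
have inj_h : injective h.
  by move=> c d eq_cd; apply/ffunP => v; apply: ord_inj; rewrite -!hE eq_cd.
pose B := [fset h c | c in {: {ffun D -> 'I_N}}]%fset.
have inB n : (n `<=` m)%mset -> n \in B.
  move=> /msubsetP le_nm; apply/imfsetP.
  have ltnN (v : D) : (n (val v) < N)%N by rewrite (leq_ltn_trans (le_nm _)).
  exists [ffun v => Ordinal (ltnN v)] => //; apply/msetP => v.
  have [vD|vD] := boolP (v \in D); first by rewrite (hE _ [` vD]%fset) ffunE.
  rewrite h_out //; apply/eqP; rewrite -leqn0 (leq_trans (le_nm v)) //.
  by rewrite leqn0; move: vD; rewrite mem_finsupp negbK.
rewrite [LHS](fs_mulE _ _ inB) big_imfset => [|c d _ _ /inj_h //] /=.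
under [RHS]eq_bigr => v _ do rewrite (cauchy_widen _ _ (ltN v)).
rewrite bigA_distr_bigA /= big_enum /=; apply: eq_bigr => c _.
rewrite bigA_distr_big_dep big_mkcond big_imfset => [|? ? _ _ /inj_h //] /=.
rewrite big_enum [RHS]big_mkcond /=; apply: eq_bigr => d _.
rewrite !(eseries_fsub _ (supp_h _)) // -big_split /=.
have -> : (h c `+` h d == m)%mset =
    (d \in family (fun (i : D) (j : 'I_N) => (c i + j == m (val i))%N)).
  apply/eqP/familyP => [def_m v|eq_m]; first by rewrite unfold_in -def_m msetE2 !hE.
  apply/msetP => v; rewrite msetE2; have [vD|vD] := boolP (v \in D).
    by have := eq_m [` vD]%fset; rewrite unfold_in -!hE => /eqP.
  by rewrite !h_out //; move: vD; rewrite mem_finsupp negbK => /eqP.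
by case: ifP => // _; apply: eq_bigr => v _; rewrite !hE.
Qed.

Lemma eseries1 : eseries (fun _ k => (k == 0)%:R) = 1.
Proof.
apply/funext => m; rewrite /eseries -[RHS]/((m == mset0)%:R).
have [->|m_neq0] := eqVneq m mset0.
  by rewrite big1_seq // => v /= _; rewrite mset0E.
have [v vm] : exists v, v \in finsupp m.
  by apply/fset0Pn; apply: contraNneq m_neq0 => m0; apply/eqP/msetP => v;
     rewrite mset0E; apply/eqP; rewrite -[_ == _]negbK -mem_finsupp m0.
rewrite (big_fsetD1 v) //=; move: vm; rewrite mem_finsupp => /negPf ->.
by rewrite mul0r.
Qed.

Implicit Types p q : V -> {poly R}.

Definition epoly (p : V -> {poly R}) := eseries (fun v k => (p v)`_k).

Definition unitary p := forall v, (p v)`_0 = 1.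

Lemma epolyM p q : unitary p -> unitary q ->
  epoly p * epoly q = epoly (fun v => p v * q v).
Proof.
move=> p1 q1; rewrite /epoly eseriesM //; congr eseries.
by apply/funext => v; apply/funext => k; rewrite coefM.
Qed.

Lemma unitary_prod (J : Type) (s : seq J) (P : J -> V -> {poly R}) :
  (forall j, unitary (P j)) -> unitary (fun v => \prod_(j <- s) P j v).
Proof.
move=> P1 v; elim: s => [|j s IHs]; first by rewrite big_nil coef1.
by rewrite big_cons coefM big_ord1 subn0 P1 IHs mulr1.
Qed.

Lemma epoly1 : epoly (fun _ => 1) = 1.
Proof.
by rewrite -eseries1; congr eseries; apply/funext => v; apply/funext => k;
   rewrite coef1.
Qed.

Lemma epoly_prod (J : Type) (s : seq J) (P : J -> V -> {poly R}) :
  (forall j, unitary (P j)) ->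
  \prod_(j <- s) epoly (P j) = epoly (fun v => \prod_(j <- s) P j v).
Proof.
move=> P1; elim: s => [|j s IHs].
  by rewrite big_nil -epoly1; congr epoly; apply/funext => v; rewrite big_nil.
rewrite big_cons IHs epolyM //; last exact: unitary_prod.
by congr epoly; apply/funext => v; rewrite big_cons.
Qed.

(** The geometric series of 1 - p gives the coefficients of the inverse of p; its powers beyond k do
    not reach degree k when p has constant coefficient 1. *)
Definition poly_inv_coef (p : {poly R}) (k : nat) : R :=
  (\sum_(i < k.+1) (1 - p) ^+ i)`_k.

Lemma coefX_lt (p : {poly R}) i k : p`_0 = 0 -> (k < i)%N -> (p ^+ i)`_k = 0.
Proof.
move=> p0; elim: i k => // i IHi k ltki; rewrite exprS coefM big1 // => -[j /=].
rewrite ltnS => le_jk _; case: j le_jk => [|j] ltjk; first by rewrite p0 mul0r.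
by rewrite IHi ?mulr0 // (leq_trans _ (ltki : (k <= i)%N)) // ltn_subrL (leq_ltn_trans _ ltjk).
Qed.

Lemma poly_inv_coef_widen (p : {poly R}) k n : p`_0 = 1 -> (k < n)%N ->
  poly_inv_coef p k = (\sum_(i < n) (1 - p) ^+ i)`_k.
Proof.
move=> p1 ltkn; rewrite /poly_inv_coef !coef_sum.
rewrite (big_ord_widen n (fun i => ((1 - p) ^+ i)`_k)) // big_mkcond /=.
apply: eq_bigr => i _; case: ltnP => // ltki.
by rewrite coefX_lt // coefB coef1 p1 subrr.
Qed.

Lemma cauchy_poly_inv (p : {poly R}) k : p`_0 = 1 ->
  cauchy (fun i => p`_i) (poly_inv_coef p) k = (k == 0)%:R.
Proof.
move=> p1; pose s := \sum_(i < k.+1) (1 - p) ^+ i.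
transitivity ((p * s)`_k).
  rewrite coefM; apply: eq_bigr => i _.
  by rewrite (poly_inv_coef_widen p1 (_ : k - i < k.+1)%N) // ltnS leq_subr.
have -> : p * s = 1 - (1 - p) ^+ k.+1.
  have := subrXX 1 (1 - p) k.+1; rewrite expr1n subKr => ->; congr (_ * _).
  by apply: eq_bigr => i _; rewrite expr1n mul1r.
by rewrite coefB coefX_lt ?subr0 ?coef1 // coefB coef1 p1 subrr.
Qed.

Lemma poly_inv_coef0 (p : {poly R}) : poly_inv_coef p 0 = 1.
Proof. by rewrite /poly_inv_coef big_ord1 expr0 coef1. Qed.

Definition epoly_inv p := eseries (fun v => poly_inv_coef (p v)).

Lemma epolyVr p : unitary p -> epoly p * epoly_inv p = 1.
Proof.
move=> p1; rewrite eseriesM //; last by move=> v; rewrite poly_inv_coef0.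
rewrite -eseries1; congr eseries; apply/funext => v; apply/funext => k.
exact: cauchy_poly_inv.
Qed.

Lemma epoly_unit p : unitary p -> epoly p \is a GRing.unit.
Proof. by move=> p1; apply/unitrPr; exists (epoly_inv p); exact: epolyVr. Qed.

Lemma epolyV p : unitary p -> (epoly p)^-1 = epoly_inv p.
Proof.
by move=> p1; apply: (mulrI (epoly_unit p1)); rewrite epolyVr // divrr ?epoly_unit.
Qed.

(** A coefficient at m depends only on the finitely many variables in m, so it is constant once the
    index set contains the thresholds of all these variables. *)
Lemma epoly_infprod (J : choiceType) (P : J -> V -> {poly R}) (L : V -> {poly R}) :
    (forall j, unitary (P j)) ->
    (forall v, exists S0 : {fset J}, forall S : {fset J}, (S0 `<=` S)%fset ->
      \prod_(j <- S) P j v = L v) ->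
  fs_infprod (fun j => (epoly (P j))^-1) = (epoly L)^-1.
Proof.
move=> P1 lim; have /choice[S0 limE] := lim.
have L1 : unitary L by move=> v; rewrite -(limE v _ (fsubset_refl _)) unitary_prod.
rewrite epolyV //; apply/funext => m.
have prodE (S : {fset J}) : \prod_(j <- S) (epoly (P j))^-1 =
    epoly_inv (fun v => \prod_(j <- S) P j v).
  rewrite -epolyV; last exact: unitary_prod.
  rewrite -epoly_prod //; elim: (enum_fset S) => [|j s IHs].
    by rewrite !big_nil invr1.
  rewrite !big_cons IHs mulrC -invrM ?epoly_unit //.
  by rewrite epoly_prod // epoly_unit //; apply: unitary_prod.
rewrite /fs_infprod; pose T0 := (\bigcup_(v <- finsupp m) S0 v)%fset.
have T0E (S : {fset J}) : (T0 `<=` S)%fset ->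
    (\prod_(j <- S) (epoly (P j))^-1) m = epoly_inv L m.
  move=> subS; rewrite prodE; apply: eq_big_seq => v vm.
  rewrite (limE v S) //; apply: fsubset_trans subS.
  by apply/fsubsetP => j jv; apply/bigfcupP; exists v; rewrite ?vm.
case: xgetP => [c _ [S1 S1E]|no_c]; last by case: (no_c (epoly_inv L m)); exists T0.
by rewrite -(S1E (S1 `|` T0)%fset) ?fsubsetUl // T0E // fsubsetUr.
Qed.

End EulerSeries.

(** * Polynomials in one variable as Euler products *)

Section LocalFactors.
Local Open Scope ring_scope.
Variables (V : choiceType) (R : comNzRingType).
Implicit Types (c : R) (m n : monomial V) (g : fseries V R).

Definition fs_term c n : fseries V R := fun m => if m == n then c else 0.

Lemma fs_termM c n g m :
  (fs_term c n * g) m = if (n `<=` m)%mset then c * g (m `\` n)%mset else 0.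
Proof.
pose B := fset_set [set k : monomial V | (k `<=` m)%mset].
have inB k : (k \in B) = (k `<=` m)%mset.
  by rewrite in_fset_set ?inE; [apply: asboolb | exact: finite_msubset].
rewrite [LHS](@fs_mulE _ _ B) => [|k]; last by rewrite inB.
have [le_nm|not_le] := boolP (n `<=` m)%mset; last first.
  rewrite big1_seq // => x; rewrite /= inB /fs_term; case: eqP => [->|_ _].
    by rewrite (negPf not_le).
  by rewrite big1 // => y _; rewrite mul0r.
rewrite (big_fsetD1 n) ?inB //= [X in _ + X]big1_seq ?addr0 => [|x]; last first.
  rewrite /= in_fsetD1 => /andP[/negPf neq_xn _].
  by rewrite big1 // => y _; rewrite /fs_term neq_xn mul0r.
rewrite big_mkcond (big_fsetD1 (m `\` n)%mset) /=; last first.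
  by rewrite inB; apply/msubsetP => v; rewrite msetE2 leq_subr.
rewrite msetBDKC // eqxx big1_seq ?addr0 => [|y /=]; last first.
  rewrite in_fsetD1 => /andP[neq_y _]; case: eqP => // def_m.
  case/eqP: neq_y; apply/msetP => v; rewrite -def_m.
  by rewrite !msetE2 addnC addnK.
by rewrite /fs_term eqxx.
Qed.

Lemma fs_constM c g m : (fs_const c * g) m = c * g m.
Proof. by rewrite [LHS]fs_termM multiset.msub0set msetB0. Qed.

Fact fs_const_is_additive : zmod_morphism (@fs_const V R).
Proof.
move=> c d; apply/funext => m; rewrite /fs_const.
by rewrite -[RHS]/((_ : R) - _); case: eqP => //; rewrite subr0.
Qed.

Fact fs_const_is_multiplicative : monoid_morphism (@fs_const V R).
Proof.
split; first by apply/funext => m; rewrite -[RHS]/((m == mset0)%:R) /fs_const; case: eqP.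
move=> c d; apply/funext => m; rewrite fs_constM /fs_const.
by case: eqP => //; rewrite mulr0.
Qed.

HB.instance Definition _ := GRing.isZmodMorphism.Build R (fseries V R)
  (@fs_const V R) fs_const_is_additive.
HB.instance Definition _ := GRing.isMonoidMorphism.Build R (fseries V R)
  (@fs_const V R) fs_const_is_multiplicative.

Lemma fs_varX (v : V) k : fs_var R v ^+ k = fs_term 1 (msetn k v).
Proof.
elim: k => [|k IHk]; apply/funext => m.
  by rewrite -[LHS]/((m == mset0)%:R) msetn0 /fs_term; case: eqP.
have -> : fs_var R v ^+ k.+1 = fs_term 1 (msetn 1 v) * fs_term 1 (msetn k v).
  rewrite exprS IHk; congr (_ * _); apply/funext => n.
  by rewrite /fs_var /fs_term; case: eqP.
rewrite fs_termM mul1r /fs_term.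
have [le1|not_le1] := boolP (msetn 1 v `<=` m)%mset; last first.
  case: eqP => // def_m; case/negP: not_le1; apply/msubsetP => u.
  by rewrite def_m !msetnE; case: eqP.
have /msubsetP/(_ v) := le1; rewrite msetnxx => mv_gt0.
have -> //: (m `\` msetn 1 v == msetn k v)%mset = (m == msetn k.+1 v).
apply/eqP/eqP => [def_m|->]; apply/msetP => u; last first.
  by rewrite msetE2 !msetnE; case: eqP => // _; rewrite subn1.
have := congr1 (fun n : monomial V => n u) def_m.
rewrite msetE2 !msetnE; case: eqP => [->|_]; last by rewrite subn0.
by rewrite subn1 => <-; rewrite prednK.
Qed.

Definition single (u : V) (p : {poly R}) : V -> {poly R} :=
  fun v => if v == u then p else 1.

Lemma unitary_single u (p : {poly R}) : p`_0 = 1 -> unitary (single u p).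
Proof. by move=> p0 v; rewrite /single; case: eqP => // _; rewrite coef1. Qed.

(** This links the coefficient formula with the polynomials in one variable that occur in the
    definitions. A monomial that is not a power of u contains another variable, at which the factor
    1 contributes the coefficient 0. *)
Lemma epoly_single u (p : {poly R}) : p`_0 = 1 ->
  epoly (single u p) = (map_poly (@fs_const V R) p).[fs_var R u].
Proof.
move=> p0; rewrite (@horner_coef_wide _ (size p)) ?size_poly //.
apply/funext => m.
have -> : (\sum_(i < size p) (map_poly (@fs_const V R) p)`_i * fs_var R u ^+ i) m
    = \sum_(i < size p) p`_i * (m == msetn i u)%:R.
  elim/big_rec2: _ => // i x y _ <-; rewrite fs_addE coef_map fs_varX fs_constM.
  by rewrite /fs_term; case: eqP.
have s1 : forall v, (single u p v)`_0 = 1 by exact: unitary_single.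
have [mE|neq_m] := eqVneq m (msetn (m u) u); last first.
  rewrite [RHS]big1 => [|i _]; last first.
    by case: eqP => [def_m|_]; rewrite ?mulr0 //; move: neq_m; rewrite def_m msetnxx eqxx.
  suff [v vm neq_vu] : exists2 v, v \in finsupp m & v != u.
    rewrite /epoly /eseries (big_fsetD1 v) //= /single (negPf neq_vu) coef1.
    by move: vm; rewrite mem_finsupp => /negPf->; rewrite mul0r.
  apply: contrapT => no_v; case/eqP: neq_m; apply/msetP => v.
  rewrite msetnE; case: eqP => [-> //|/eqP neq_vu]; apply/eqP.
  by apply: contrapT => /negP vm; case: no_v; exists v; rewrite ?mem_finsupp.
have -> : epoly (single u p) m = p`_(m u).
  rewrite [LHS](@eseries_fsub _ _ _ [fset u]%fset) //; last first.
    apply/fsubsetP => v; rewrite mem_finsupp inE {1}mE msetnE.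
    by case: (v == u).
  by rewrite -(big_seq_fsetE _ _ predT (fun v => (single u p v)`_(m v))) big_seq_fset1 /single eqxx.
have msetnI i : (m == msetn i u) = (m u == i).
  by apply/eqP/eqP => [->|<- //]; rewrite msetnxx.
have [lt_mu|ge_mu] := ltnP (m u) (size p).
  rewrite (bigD1 (Ordinal lt_mu)) //= msetnI eqxx mulr1 big1 ?addr0 // => i.
  by rewrite -val_eqE /= msetnI eq_sym => /negPf ->; rewrite mulr0.
rewrite nth_default // big1 // => i _; rewrite msetnI gtn_eqF ?mulr0 //.
exact: leq_trans (ltn_ord i) ge_mu.
Qed.

End LocalFactors.

(** * Products over the variables of one prime and over all primes *)

Section EulerProducts.
Local Open Scope ring_scope.
Variables (R : comNzRingType) (T : choiceType).
Let V : choiceType := (T * nat)%type.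
Implicit Types (h : {poly R}) (H : T -> {poly R}) (q : T).

Definition block q h : V -> {poly R} := fun v => if v.1 == q then h else 1.

Lemma unitary_block q h : h`_0 = 1 -> unitary (block q h).
Proof. by move=> h0 v; rewrite /block; case: eqP => // _; rewrite coef1. Qed.

Lemma infprod_block q h : h`_0 = 1 ->
  fs_infprod (fun i => (map_poly (@fs_const V R) h).[fs_var R (q, i)]^-1)
  = (epoly (block q h))^-1.
Proof.
move=> h0.
rewrite -(@epoly_infprod V R _ (fun i => single (q, i) h)) => [|i|v].
- by congr fs_infprod; apply/funext => i; rewrite epoly_single.
- exact: unitary_single.
(* Only the factor of index [v.2] can differ from 1 at the variable [v]. *)
exists [fset v.2]%fset => S; rewrite fsub1set => vS; case: v vS => q' i /= iS.
rewrite (big_fsetD1 i) //= big1_seq ?mulr1 => [|j /=]; last first.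
  by rewrite in_fsetD1 /single xpair_eqE [i == j]eq_sym => /andP[/negPf->]; rewrite andbF.
by rewrite /single /block xpair_eqE eqxx andbT.
Qed.

Lemma infprod_blocks H : (forall q, (H q)`_0 = 1) ->
  fs_infprod (fun q => (epoly (block q (H q)))^-1)
  = (epoly (fun v : V => H v.1))^-1.
Proof.
move=> H0.
rewrite -(@epoly_infprod V R _ (fun q => block q (H q))) // => [q|v].
  exact: unitary_block.
exists [fset v.1]%fset => S; rewrite fsub1set => vS.
rewrite (big_fsetD1 v.1) //= big1_seq ?mulr1 => [|j /=]; last first.
  by rewrite in_fsetD1 /block eq_sym => /andP[/negPf->].
by rewrite /block eqxx.
Qed.

Lemma epoly_blockXn q h n : h`_0 = 1 ->
  (epoly (block q h))^-1 ^+ n = (epoly (block q (h ^+ n)))^-1.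
Proof.
move=> h0; have u0 := unitary_block q h0.
rewrite exprVn; congr (_^-1); rewrite -{1}[n]subn0 -prodr_const_nat.
rewrite (epoly_prod _ (fun=> u0)); congr epoly; apply/funext => v.
rewrite prodr_const_nat subn0 /block.
by case: eqP => // _; rewrite expr1n.
Qed.

End EulerProducts.

(** * Membership in the completed ring *)

Section Completed.
Local Open Scope ring_scope.
Variables (R : realType) (K : fieldExtType rat).
Local Notation C := R[i].
Local Notation V := (sym_var K).
Variables (E : splittingFieldType rat) (phi : {rmorphism E -> C}).
Hypotheses (galE : galois 1%AS {:E}) (abE : abelian 'Gal({:E} / 1%AS)%g).

Lemma poly_inv_coef_map (h : {poly E}) k :
  poly_inv_coef (map_poly phi h) k = phi (poly_inv_coef h k).
Proof.
rewrite /poly_inv_coef -coef_map rmorph_sum /= !coef_sum.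
by apply: eq_bigr => i _; rewrite rmorphXn rmorphB rmorph1.
Qed.

(** The factor depends on the prime alone, so permuting the indices for each prime merely reindexes
    the product over the support. The coefficients are values of integer polynomials at those of the
    [H q], hence lie in the image of the abelian field E. *)
Lemma completed_epolyV (H : prime_ideal K -> {poly C}) :
    (forall q, (H q)`_0 = 1) ->
    (forall q, exists h : {poly E}, H q = map_poly phi h) ->
  completed_AK R K (epoly (fun v : V => H v.1))^-1.
Proof.
move=> H0 /choice[h hE]; rewrite epolyV; last by move=> v; exact: H0.
split=> [m n [s [bij_s mE]]|m]; last first.
  exists E, phi, (\prod_(v <- finsupp m) poly_inv_coef (h v.1) (m v)); split=> //.
  by rewrite rmorph_prod; apply: eq_bigr => v _; rewrite hE poly_inv_coef_map.
pose t (v : V) : V := (v.1, s v.1 v.2).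
have mt v : m v = n (t v) by case: v => q i; exact: mE.
have supp_n : finsupp n = [fset t v | v in finsupp m]%fset.
  apply/fsetP => -[q i]; apply/idP/imfsetP => [|[v /= + ->]]; last first.
    by rewrite !mem_finsupp mt.
  rewrite mem_finsupp => nqi; have [s' sK s'K] := bij_s q.
  by exists ((q, s' i) : V); rewrite ?mem_finsupp ?mt /t /= s'K.
rewrite /epoly_inv /eseries supp_n big_imfset => [|u v _ _] /=.
  by apply: eq_bigr => v _; rewrite mt.
rewrite /t => -[eq1]; rewrite eq1 => /(bij_inj (bij_s v.1)) eq2.
by case: u v eq1 eq2 => [q i] [q' i'] /= -> ->.
Qed.

End Completed.

(** * The zeta and Artin functions as inverses of Euler products *)

Section EulerFactors.
Local Open Scope ring_scope.

Definition rev_char_poly (F : comNzRingType) n (M : 'M[F]_n) : {poly F} :=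
  \det (1%:M - 'X *: map_mx polyC M).

Lemma horner_rev_char_poly (F : comNzRingType) n (M : 'M[F]_n) x :
  (rev_char_poly M).[x] = \det (1%:M - x *: M).
Proof.
rewrite /rev_char_poly -horner_evalE -det_map_mx; congr (\det _).
by apply/matrixP => i j; rewrite !mxE /= horner_evalE !hornerE hornerMn hornerC.
Qed.

Lemma map_rev_char_poly (F F' : comNzRingType) (f : {rmorphism F -> F'}) n
  (M : 'M[F]_n) : map_poly f (rev_char_poly M) = rev_char_poly (map_mx f M).
Proof.
rewrite /rev_char_poly -det_map_mx; congr (\det _).
apply/matrixP => i j; rewrite !mxE /=.
by rewrite rmorphB rmorphM /= map_polyX map_polyC /= rmorphMn rmorph1.
Qed.

Lemma coef0_rev_char_poly (F : comNzRingType) n (M : 'M[F]_n) :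
  (rev_char_poly M)`_0 = 1.
Proof. by rewrite -horner_coef0 horner_rev_char_poly scale0r subr0 det1. Qed.

Variables (R : realType) (K : fieldExtType rat).

Lemma zetaE : zeta R K = (epoly (fun v : sym_var K => 1 - 'X))^-1.
Proof.
have X0 : (1 - 'X : {poly R[i]})`_0 = 1 by rewrite coefB coef1 coefX mulr0n subr0.
rewrite -(@infprod_blocks _ _ (fun=> 1 - 'X)) //; congr fs_infprod; apply/funext => q.
rewrite -infprod_block //; congr fs_infprod; apply/funext => i.
by rewrite rmorphB rmorph1 /= map_polyX !hornerE.
Qed.

Lemma zeta_relE (L : fieldExtType K) (f g : prime_ideal K -> nat) :
    (forall q, (0 < f q)%N) ->
    (forall q (p : prime_ideal L), lies_over p q -> residue_degree p q = f q) ->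
    (forall q, finite_set [set p : prime_ideal L | lies_over p q] /\
      #|` fset_set [set p : prime_ideal L | lies_over p q]| = g q) ->
  zeta_rel R L = (epoly (fun v : sym_var K => (1 - 'X^(f v.1)) ^+ g v.1))^-1.
Proof.
move=> f_gt0 fE gE.
have X0 q : (1 - 'X^(f q) : {poly R[i]})`_0 = 1.
  by rewrite coefB coef1 coefXn eqxx ltn_eqF ?f_gt0 // subr0.
rewrite -(@infprod_blocks _ _ (fun q => (1 - 'X^(f q)) ^+ g q)) => [|q]; last first.
  by rewrite -horner_coef0 horner_exp horner_coef0 X0 expr1n.
congr fs_infprod; apply/funext => q; have [finq <-] := gE q.
rewrite fsbig_finite // -epoly_blockXn //.
transitivity (\prod_(p <- fset_set [set p : prime_ideal L | lies_over p q])
    (epoly (block q (1 - 'X^(f q))))^-1 : fseries (sym_var K) R[i]); last first.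
  by rewrite big_const_seq count_predT iter_mulr_1.
apply: eq_big_seq => p; rewrite in_fset_set // inE => /fE ->.
rewrite -infprod_block //; congr fs_infprod; apply/funext => i.
by rewrite rmorphB rmorph1 /= map_polyXn !hornerE.
Qed.

Lemma artinE (L : splittingFieldType K) n
    (rho : mx_representation R[i] 'Gal({:L} / 1%AS)%G n) P :
  artin rho P =
  (epoly (fun v : sym_var K => rev_char_poly (frobenius_mx rho P v.1)))^-1.
Proof.
rewrite -(@infprod_blocks _ _ (fun q => rev_char_poly (frobenius_mx rho P q))).
  congr fs_infprod; apply/funext => q.
  rewrite -infprod_block; last exact: coef0_rev_char_poly.
  congr fs_infprod; apply/funext => i.
  by rewrite map_rev_char_poly horner_rev_char_poly.
by move=> q; exact: coef0_rev_char_poly.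
Qed.

End EulerFactors.

(** * Power sums and characters *)

Section RootsOfUnity.
Local Open Scope ring_scope.
Variable F : numFieldType.
Implicit Types (s : seq F) (N f t : nat).

Lemma sum_unity_root (w : F) f : w ^+ f = 1 ->
  \sum_(k < f) w ^+ k = (if w == 1 then f%:R else 0).
Proof.
move=> wf1; case: eqP => [->|/eqP w_neq1].
  by under eq_bigr do rewrite expr1n; rewrite sumr_const card_ord.
apply/eqP; have := subrX1 w f; rewrite wf1 subrr => /esym/eqP.
by rewrite mulf_eq0 subr_eq0 (negPf w_neq1).
Qed.

(* Fourier inversion on the group of N-th roots of unity recovers the
   multiplicities from the power sums *)
Lemma perm_eq_power_sums N s1 s2 : (0 < N)%N ->
    {in s1, forall x, x ^+ N = 1} -> {in s2, forall x, x ^+ N = 1} ->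
    (forall t, \sum_(x <- s1) x ^+ t = \sum_(x <- s2) x ^+ t) ->
  perm_eq s1 s2.
Proof.
move=> N_gt0 s1N s2N eq_sums.
have countE s y : y ^+ N = 1 -> {in s, forall x, x ^+ N = 1} ->
    (count_mem y s)%:R * N%:R = \sum_(t < N) y^-1 ^+ t * \sum_(x <- s) x ^+ t.
  move=> yN sN; have y_neq0 : y != 0.
    by apply: contra_eq_neq yN => ->; rewrite expr0n gtn_eqF // eq_sym oner_eq0.
  under [RHS]eq_bigr do rewrite mulr_sumr.
  rewrite exchange_big /= -sum1_count natr_sum mulr_suml big_mkcond /=.
  apply: eq_big_seq => x /sN xN; under [RHS]eq_bigr do rewrite -exprMn.
  rewrite sum_unity_root; last by rewrite exprMn exprVn yN xN invr1 mulr1.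
  have -> : (y^-1 * x == 1) = (x == y).
    by rewrite mulrC -(inj_eq (mulIf y_neq0)) divfK // mul1r.
  by case: eqP; rewrite ?mul1r.
have NR : N%:R != 0 :> F by rewrite pnatr_eq0 -lt0n.
rewrite /perm_eq; apply/allP => x /=; rewrite mem_cat => xs.
have xN : x ^+ N = 1 by case/orP: xs => [/s1N|/s2N].
rewrite -(eqr_nat F); apply/eqP/(mulIf NR); rewrite !countE //.
by apply: eq_bigr => t _; rewrite eq_sums.
Qed.

Lemma prod_1subXn f (z : F) : f.-primitive_root z ->
  \prod_(k < f) (1 - (z^-1 ^+ k) *: 'X) = 1 - 'X^f :> {poly F}.
Proof.
move=> prz; have f_gt0 := prim_order_gt0 prz.
have z_neq0 : z != 0.
  apply: contra_eq_neq (prim_expr_order prz) => ->.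
  by rewrite expr0n gtn_eqF // eq_sym oner_eq0.
(* Each factor is -z^(-k) times X - z^k; the product [c] of these scalars is found to be -1 by
   setting X to 0. *)
pose c : F := \prod_(k < f) - z^-1 ^+ k.
have prodE : \prod_(k < f) (1 - (z^-1 ^+ k) *: 'X) = c *: ('X^f - 1) :> {poly F}.
  rewrite -(factor_Xn_sub_1 prz) big_mkord -scaler_prod; apply: eq_bigr => k _.
  rewrite scalerBr !scaleNr opprK addrC; congr (_ + _).
  by rewrite -mul_polyC -polyCM exprVn mulVf ?expf_neq0.
have cE : c = -1.
  have := congr1 (horner^~ 0) prodE; rewrite horner_prod big1 => [|k _]; last first.
    by rewrite !hornerE subr0.
  rewrite !hornerE expr0n gtn_eqF // sub0r mulrN1 => /esym/eqP.
  by rewrite eqr_oppLR => /eqP.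
by rewrite prodE cE scaleN1r opprB.
Qed.

End RootsOfUnity.

(** * Eigenvalues of matrices of finite order *)

Section Spectrum.
Local Open Scope ring_scope.
Variable F : numFieldType.

Lemma expmx_conj n (P M : 'M[F]_n) (d : 'rV_n) t :
  P \in unitmx -> P *m M = diag_mx d *m P ->
  P *m (M ^+ t) = diag_mx (\row_i d 0 i ^+ t) *m P.
Proof.
move=> uP PM; elim: t => [|t IHt].
  rewrite expr0 mulmx1 -[LHS]mul1mx; congr (_ *m _); apply/matrixP => i j.
  by rewrite !mxE expr0; case: eqP.
rewrite exprS [M * _]/(M *m _) mulmxA PM -mulmxA IHt mulmxA; congr (_ *m _).
rewrite mulmx_diag; congr diag_mx; apply/rowP => i.
by rewrite !mxE exprS.
Qed.

(** M is a root of X^N - 1, which splits with distinct roots in F thanks to z. Hence M is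
    diagonalizable, and s lists its diagonal entries. *)
Lemma finite_order_spectrum n (M : 'M[F]_n) N (z : F) :
    N.-primitive_root z -> M ^+ N = 1%:M ->
  exists s : seq F,
    [/\ {in s, forall x, x ^+ N = 1},
        rev_char_poly M = \prod_(x <- s) (1 - x *: 'X)
      & forall t, \tr (M ^+ t) = \sum_(x <- s) x ^+ t].
Proof.
move=> prz MN; case: n => [|n] in M MN *.
  exists [::]; split=> // [|t]; first by rewrite /rev_char_poly det_mx00 big_nil.
  by rewrite /mxtrace big_ord0 big_nil.
have [P uP /diagonalizable_forPex[d /(simmxP uP) PM]] : diagonalizable M.
  apply/diagonalizableP; exists [seq z ^+ i | i <- index_iota 0 N].
    rewrite map_inj_in_uniq ?iota_uniq // => i j.
    rewrite !mem_index_iota /= => ltiN ltjN /eqP.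
    by rewrite (eq_prim_root_expr prz) !modn_small // => /eqP.
  rewrite big_map factor_Xn_sub_1 //; apply: mxminpoly_min.
  by rewrite rmorphB rmorphXn rmorph1 /= horner_mx_X MN subrr.
exists [seq d 0 i | i <- enum 'I_n.+1]; split.
- move=> _ /mapP[i _ ->]; have := expmx_conj N uP PM.
  rewrite MN mulmx1 => /(congr1 (mulmx^~ (invmx P))); rewrite mulmxK // mulmxV //.
  by move/matrixP/(_ i i); rewrite !mxE eqxx /= mulr1n.
- rewrite big_map big_enum /= /rev_char_poly; set A := _ - _.
  have PA : map_mx polyC P *m A = diag_mx (\row_i (1 - d 0 i *: 'X)) *m map_mx polyC P.
    rewrite mulmxBr mulmx1 -scalemxAr -map_mxM PM map_mxM map_diag_mx.
    rewrite scalemxAl -[X in X - _]mul1mx -mulmxBl; congr (_ *m _).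
    apply/matrixP => i j; rewrite !mxE; case: eqP => _; last by rewrite !mulr0n mulr0 subr0.
    by rewrite !mulr1n -mul_polyC mulrC.
  have dP : \det (map_mx polyC P) != 0.
    by rewrite det_map_mx polyC_eq0 -unitfE -unitmxE.
  have /(congr1 determinant) := PA; rewrite !det_mulmx mulrC det_diag.
  by move/(mulIf dP) ->; apply: eq_bigr => i _; rewrite mxE.
- move=> t; rewrite big_map big_enum /=; have := expmx_conj t uP PM.
  move/(canRL (mulKmx uP)) ->; rewrite mxtrace_mulC -mulmxA mulmxV // mulmx1.
  by rewrite mxtrace_diag; apply: eq_bigr => i _; rewrite mxE.
Qed.

End Spectrum.

(** * The character of the regular representation *)

Section RegularCharacter.
Local Open Scope ring_scope.
Variables (F : numClosedFieldType) (gT : finGroupType) (G : {group gT}).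

(** The element x permutes the basis indexed by G by translation, without fixed points unless x =
    1. *)
Lemma mxtrace_regular_repr (x : gT) : x \in G ->
  \tr (regular_repr F G x) = (if x == 1%g then #|G|%:R else 0).
Proof.
move=> Gx; rewrite /mxtrace.
have diagE i : regular_repr F G x i i = (x == 1%g)%:R.
  rewrite !mxE eqxx /=; congr (_%:R); congr nat_of_bool.
  rewrite -(inj_eq enum_val_inj) gring_indexK ?groupM ?enum_valP //.
  by rewrite eq_sym -[RHS](inj_eq (mulgI (enum_val i))) mulg1.
under eq_bigr do rewrite diagE; rewrite sumr_const card_ord.
by case: eqP; rewrite ?mul0rn.
Qed.

Lemma mx_rsim_trivial n1 n2 (r1 : mx_representation F G n1)
    (r2 : mx_representation F G n2) : n1 = n2 ->
  {in G, forall x, r1 x = 1%:M} -> {in G, forall x, r2 x = 1%:M} -> mx_rsim r1 r2.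
Proof.
move=> eq_n; case: _ / eq_n r2 => r2 r1E r2E.
apply: (MxReprSim (B := 1%:M)) => // [|x Gx]; first by rewrite row_free_unit unitmx1.
by rewrite r1E // r2E.
Qed.

(** The regular representation contains each irreducible as often as its degree. The trivial one
    contributes the term 1, and the system matches the other irreducible components one to one. *)
Lemma sum_irr_system_trace (J : finType) (d : J -> nat)
    (rho : forall j, mx_representation F G (d j)) (x : gT) :
    nontrivial_irr_system rho -> x \in G ->
  1 + \sum_j (d j)%:R * \tr (rho j x) = (if x == 1%g then #|G|%:R else 0).
Proof.
case=> rho_irr rho_inj rho_surj Gx; rewrite -mxtrace_regular_repr //.
have sG : irrType F G := DecSocleType (regular_repr F G).
have F'G : ([pchar F]^').-group%g G.
  by apply/pgroupP => p _ _; rewrite inE /= pchar_num.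
have splitG : group_splitting_field F G by exact: group_closure_closed_field.
rewrite (mxtrace_regular_pchar sG) // (bigD1 (principal_comp sG)) //=.
have rsim1 : mx_rsim (irr_repr (principal_comp sG)) (trivial_representation F G).
  by apply: mx_rsim_trivial => //; [rewrite degree_irr1 | exact: irr1_repr].
have tr1 : \tr (irr_repr (principal_comp sG) x) = 1.
  by rewrite (mxtrace_rsim rsim1) // mxtrace1.
rewrite [X in X *+ _]tr1 degree_irr1; congr (_ + _).
pose c j := irr_comp sG (rho j).
have rsim_c j : mx_rsim (rho j) (irr_repr (c j)).
  by apply: rsim_irr_comp_pchar => //; case: (rho_irr j).
have inj_c : injective c.
  move=> j k eq_c; apply: rho_inj; apply: mx_rsim_trans (rsim_c j) _.
  by rewrite eq_c; apply: mx_rsim_sym.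
have im_c : [set i | i != principal_comp sG]%SET = [set c j | j in J]%SET.
  apply/setP => i; rewrite inE; apply/idP/imsetP => [i_neq1|[j _ ->]]; last first.
    apply/eqP => cj1; case: (rho_irr j) => _; apply.
    by apply: mx_rsim_trans rsim1; rewrite -cj1.
  have [||j rsim_j] := rho_surj _ (irr_repr i); first exact: socle_irr.
    move=> rsim_i; case/eqP: i_neq1.
    rewrite -(irr_reprK_pchar F'G i) -(irr_reprK_pchar F'G (principal_comp sG)).
    apply: irr_comp_rsim_pchar => //; apply: mx_rsim_trans rsim_i _.
    exact: mx_rsim_sym.
  exists j => //; rewrite -(irr_reprK_pchar F'G i).
  exact: irr_comp_rsim_pchar.
rewrite (eq_bigl (mem [set c j | j in J]%SET)) => [|i]; last first.
  by rewrite /= -im_c inE.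
rewrite big_imset => [|? ? _ _ /inj_c //] /=.
apply: eq_bigr => j _; rewrite (mxtrace_rsim (rsim_c j) Gx) mulr_natl.
by have -> : d j = irr_degree (c j) by case: (rsim_c j).
Qed.

End RegularCharacter.

(** * Traces on the fixed space and the factorization of the regular representation *)

Section FixedSpace.
Local Open Scope ring_scope.
Variables (F : numClosedFieldType) (gT : finGroupType) (G I : {group gT}).
Variables (s : gT).
Hypotheses (sIG : I \subset G) (Gs : s \in G) (nIs : s \in 'N(I)%g).

Let GI x : x \in I -> x \in G. Proof. exact: (fintype.subsetP sIG). Qed.

Section OneRepresentation.
Variables (n : nat) (rho : mx_representation F G n).
Let B := row_base (rfix_mx rho I).

(** The matrix of s on the I-fixed space; it becomes [frobenius_mx] when I is the inertia group and
    s represents the Frobenius coset. *)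
Definition fix_conj : 'M[F]_(\rank (rfix_mx rho I)) :=
  mxred.conjmx (row_base (rfix_mx rho I)) (rho s).

Let Bfix x : x \in I -> B *m rho x = B.
Proof. by apply/rfix_mxP; rewrite eq_row_base. Qed.

(** The I-fixed space is stable under s because s normalizes I. *)
Let Bs : fix_conj *m B = B *m rho s.
Proof.
rewrite /fix_conj /mxred.conjmx mulmxKpV //.
rewrite eq_row_base (eqmxMr _ (eq_row_base _)).
by have := rfix_mx_conjsg rho Gs sIG; rewrite (normP nIs) => ->.
Qed.

Let BsX t : fix_conj ^+ t *m B = B *m rho (s ^+ t)%g.
Proof.
elim: t => [|t IHt]; first by rewrite expr0 mul1mx expg0 repr_mx1 mulmx1.
rewrite exprSr -[_ ^+ t * _]/(_ ^+ t *m _) -mulmxA Bs mulmxA IHt -mulmxA expgSr.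
by rewrite repr_mxM ?groupX.
Qed.

Lemma fix_conj_order : fix_conj ^+ #|G| = 1%:M.
Proof.
apply: (row_free_inj (row_base_free (rfix_mx rho I))); rewrite -/B BsX mul1mx.
by rewrite (eqP (_ : s ^+ #|G| == 1)%g) ?repr_mx1 ?mulmx1 // -order_dvdn order_dvdG.
Qed.

(* The sum of rho over I is |I| times a projection onto the fixed space *)
Lemma mxtrace_fix_conj t :
  #|I|%:R * \tr (fix_conj ^+ t) = \sum_(i in I) \tr (rho (s ^+ t * i)%g).
Proof.
pose e := \sum_(i in I) rho i.
have e_fix : (e <= B)%MS.
  rewrite eq_row_base; apply/rfix_mxP => x Ix; rewrite mulmx_suml.
  rewrite (eq_bigr (fun i => rho (i * x)%g)) => [|i Ii]; last first.
    by rewrite repr_mxM ?GI.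
  rewrite /e [RHS](reindex_inj (mulIg x)) /=.
  by apply: eq_bigl => i; rewrite groupMr.
have Be : B *m e = #|I|%:R *: B.
  rewrite mulmx_sumr (eq_bigr (fun=> B)) => [|i /Bfix //].
  by rewrite sumr_const scaler_nat.
have BA : B *m (e *m pinvmx B) = #|I|%:R%:M.
  apply: (row_free_inj (row_base_free (rfix_mx rho I))); rewrite -/B.
  by rewrite -mulmxA mulmxKpV // Be mul_scalar_mx.
transitivity (\tr (rho (s ^+ t)%g *m e)); last first.
  rewrite mulmx_sumr raddf_sum; apply: eq_bigr => i Ii /=.
  by rewrite repr_mxM ?groupX // GI.
(* [e] factors through the fixed space, so cyclicity of the trace moves the computation there, where
   [e] acts as the scalar |I|. *)
rewrite -(mulmxKpV e_fix) mulmxA mxtrace_mulC mulmxA -BsX -mulmxA BA.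
by rewrite mul_mx_scalar mxtraceZ.
Qed.

End OneRepresentation.

Variables (J : finType) (d : J -> nat).
Variables (rho : forall j, mx_representation F G (d j)).
Variables (f g : nat) (z : F).
Hypotheses (rho_sys : nontrivial_irr_system rho).
Hypotheses (orderE : forall t, (s ^+ t \in I)%g = (f %| t)%N).
Hypotheses (cardE : #|G| = (g * f * #|I|)%N) (prz : #|G|.-primitive_root z).

Lemma regular_factorization :
  (1 - 'X^f) ^+ g = (1 - 'X) * \prod_j rev_char_poly (fix_conj (rho j)) ^+ d j.
Proof.
have /fin_all_exists[r r_spec] (j : J) :=
  finite_order_spectrum prz (fix_conj_order (rho j)).
have f_dvd : (f %| #|G|)%N.
  rewrite -orderE (eqP (_ : s ^+ #|G| == 1)%g) ?group1 //.
  by rewrite -order_dvdn order_dvdG.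
have f_gt0 : (0 < f)%N by apply: dvdn_gt0 f_dvd.
pose w := z ^+ (#|G| %/ f).
have prw : f.-primitive_root w.
  rewrite -[X in X.-primitive_root _](_ : (#|G| %/ gcdn (#|G| %/ f) #|G|)%N = f).
    exact: exp_prim_root.
  rewrite (gcdn_idPl _) ?dvdn_div //.
  by rewrite -{1}(divnK f_dvd) mulKn // divn_gt0 // dvdn_leq.
have wf : w^-1 ^+ f = 1 by rewrite exprVn prim_expr_order // invr1.
have wG : w^-1 ^+ #|G| = 1 by rewrite -(divnK f_dvd) mulnC exprM wf expr1n.
(* [l1] and [l2] list with multiplicity the lambda of the factors 1 - lambda X of the right and left
   sides. *)
pose l1 := 1 :: flatten [seq flatten (nseq (d j) (r j)) | j <- enum J].
pose l2 := flatten (nseq g [seq w^-1 ^+ k | k <- index_iota 0 f]).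
have big_nseq (T : Type) (idx : T) (op : Monoid.law idx) n x (h : F -> T) :
    \big[op/idx]_(y <- flatten (nseq n x)) h y =
    iterop n op (\big[op/idx]_(y <- x) h y) idx.
  by rewrite big_flatten bigop.big_nseq Monoid.iteropE.
have prod_l1 (h : F -> {poly F}) : \prod_(x <- l1) h x =
    h 1 * \prod_j (\prod_(x <- r j) h x) ^+ d j.
  rewrite big_cons big_flatten big_map big_enum; congr (_ * _).
  by apply: eq_bigr => j _; rewrite big_nseq.
have prod_l2 (h : F -> {poly F}) : \prod_(x <- l2) h x =
    (\prod_(k < f) h (w^-1 ^+ k)) ^+ g.
  by rewrite big_nseq big_map big_mkord.
suff perm12 : perm_eq l1 l2.
  have := prod_l2 (fun x => 1 - x *: 'X); rewrite prod_1subXn // => <-.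
  rewrite -(perm_big _ perm12) prod_l1; rewrite scale1r; congr (_ * _).
  by apply: eq_bigr => j _; have [_ -> _] := r_spec j.
apply: (perm_eq_power_sums (cardG_gt0 G)) => [x|x|t].
- rewrite inE => /orP[/eqP-> |]; first by rewrite expr1n.
  case/flattenP => _ /mapP[j _ ->] /flattenP[y /nseqP[-> _]].
  by have [rN _ _] := r_spec j; apply: rN.
- case/flattenP => y /nseqP[-> _] /mapP[k _ ->].
  by rewrite -exprM mulnC exprM wG expr1n.
have -> : \sum_(x <- l1) x ^+ t = 1 + \sum_j (d j)%:R * \tr (fix_conj (rho j) ^+ t).
  rewrite big_cons expr1n big_flatten big_map big_enum; congr (_ + _).
  apply: eq_bigr => j _; rewrite big_nseq.
  by have [_ _ ->] := r_spec j; rewrite mulr_natl.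
have -> : \sum_(x <- l2) x ^+ t = (if (f %| t)%N then (g * f)%:R else 0).
  rewrite big_nseq big_map big_mkord.
  under eq_bigr do rewrite -exprM mulnC exprM.
  rewrite sum_unity_root; last by rewrite -exprM mulnC exprM wf expr1n.
  rewrite exprVn invr_eq1 -(prim_order_dvd prw).
  by case: ifP => _; rewrite -[LHS]/(_ *+ g) ?mul0rn // -mulr_natl natrM.
(* After multiplication by |I| the traces on the fixed spaces become character sums over the coset
   s^t I. *)
have cI : #|I|%:R != 0 :> F by rewrite pnatr_eq0 -lt0n cardG_gt0.
apply: (mulfI cI); rewrite mulrDr mulr_sumr.
under eq_bigr => j _ do rewrite mulrCA mxtrace_fix_conj mulr_sumr.
rewrite exchange_big /= mulr1 -sumr_const -big_split /=.
under eq_bigr => i Ii.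
  rewrite (sum_irr_system_trace rho_sys); last by rewrite groupM ?groupX // GI.
  rewrite -eq_invg_mul.
  over.
(* Only the term i = s^(-t) is nonzero, and it occurs exactly when s^t is in I, that is when f
   divides t. *)
rewrite -big_mkcondr /= -orderE -groupV; case: ifP => [sI|sI]; last first.
  by rewrite mulr0 big_pred0 // => i; case: eqP => [<-|]; rewrite ?sI ?andbF.
rewrite (big_pred1 (s ^+ t)^-1%g) => [|i]; first by rewrite sumr_const cardE -natrM mulnC.
by apply/andP/eqP => [[_ /eqP->//]|->]; rewrite sI eqxx.
Qed.

End FixedSpace.

(** * Decomposition groups and Frobenius elements over finite residue fields *)

Section FiniteFields.
Local Open Scope ring_scope.

Lemma finField_expf1 (k : finFieldType) (x : k) : x != 0 -> x ^+ #|k|.-1 = 1.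
Proof.
move=> x_neq0; apply: (mulIf x_neq0); rewrite mul1r -exprSr prednK ?expf_card //.
by apply/card_gt0P; exists 0.
Qed.

Lemma finField_card_pred_gt0 (k : finFieldType) : (0 < #|k|.-1)%N.
Proof. by have := finNzRing_gt1 k; case: #|k| => [|[]]. Qed.

Lemma finField_generator (k : finFieldType) :
  exists2 c : k, c != 0 & forall y, y != 0 -> exists n, y = c ^+ n.
Proof.
have /cyclicP[u genu] := field_unit_group_cyclic [set: {unit k}].
exists (val u) => [|y y_neq0]; first by rewrite -unitfE; exact: valP.
have uy : y \is a GRing.unit by rewrite unitfE.
have : FinRing.unit k uy \in <[u]>%g by rewrite -genu inE.
by case/cycleP => n /(congr1 val) /= ->; exists n; rewrite -FinRing.val_unitX.
Qed.

Variables (k0 k : finFieldType).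
Hypothesis same_char : forall p, p \in [pchar k0] -> p \in [pchar k].

Lemma frobenius_pnat : [pchar k].-nat #|k0|.
Proof.
have [p _ pk0] := finPcharP k0.
have := pprimeChar_pgroup pk0; rewrite /pgroup cardsT; apply: sub_in_pnat.
by move=> r _ /eqP ->; exact: same_char.
Qed.

Definition card_frobenius (x : k) : k := x ^+ #|k0|.

Fact card_frobenius_zmod : zmod_morphism card_frobenius.
Proof. by move=> x y; rewrite /card_frobenius exprDn_pchar ?exprNn_pchar // frobenius_pnat. Qed.

Fact card_frobenius_monoid : monoid_morphism card_frobenius.
Proof. by split=> [|x y]; rewrite /card_frobenius ?expr1n ?exprMn. Qed.

(** Equality of characteristics makes |k0| a power of the characteristic of k, so this power map is
    additive. *)
Lemma card_frobenius_rmorphism :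
  exists phi : {rmorphism k -> k}, forall x, phi x = x ^+ #|k0|.
Proof.
pose addM := GRing.isZmodMorphism.Build k k card_frobenius card_frobenius_zmod.
pose mulM := GRing.isMonoidMorphism.Build k k card_frobenius card_frobenius_monoid.
pose phi : {rmorphism k -> k} := HB.pack card_frobenius addM mulM.
by exists phi.
Qed.

End FiniteFields.

(** * Prime avoidance *)

Section Avoidance.
Local Open Scope ring_scope.

(* Prime avoidance for the kernels of maps to one finite field k; the element
   1 - x ^ (|k| - 1) lies in all the kernels that do not contain x. *)
Lemma kernel_avoidance (B : comNzRingType) (k k' : finFieldType)
    (pi' : {rmorphism B -> k'}) (T : eqType) (psi : T -> {rmorphism B -> k}) (s : seq T) :
    {in s, forall t, exists2 x, pi' x = 0 & psi t x != 0} ->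
  exists2 x, pi' x = 0 & {in s, forall t, psi t x != 0}.
Proof.
elim: s => [|t s IHs] ex; first by exists 0; rewrite ?rmorph0.
have [|x pi'x psi_x] := IHs; first by move=> u us; apply: ex; rewrite inE us orbT.
have [psi_tx0|psi_tx] := eqVneq (psi t x) 0; last first.
  by exists x => // u; rewrite inE => /orP[/eqP-> //|/psi_x].
have [|a pi'a psi_ta] := ex t; first exact: mem_head.
(* Under [psi t] the sum becomes the nonzero value of [a], while the maps in s, already nonzero at
   x, kill the correction. *)
exists (x + a * (1 - x ^+ #|k|.-1)) => [|u].
  by rewrite rmorphD rmorphM pi'x pi'a mul0r addr0.
rewrite inE rmorphD rmorphM rmorphB rmorph1 rmorphXn => /orP[/eqP->|us].
  by rewrite psi_tx0 add0r expr0n gtn_eqF ?finField_card_pred_gt0 // subr0 mulr1.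
by rewrite finField_expf1 ?psi_x // subrr mulr0 addr0 psi_x.
Qed.

End Avoidance.

(** * Finite groups acting on a ring with prescribed invariants *)

Section Decomposition.
Local Open Scope ring_scope.
Variables (gT : finGroupType) (G : {group gT}) (A B : comNzRingType).
Variables (act : gT -> {rmorphism B -> B}) (iota : {rmorphism A -> B}).
Hypothesis act1 : forall x, act 1%g x = x.
Hypothesis actM : forall s t x, act (s * t)%g x = act t (act s x).
Hypothesis act_iota : forall s a, s \in G -> act s (iota a) = iota a.
Hypothesis act_fixed : forall b, {in G, forall s, act s b = b} ->
  exists a, b = iota a.

Lemma invariant_prod (x : B) : exists a, \prod_(s in G) act s x = iota a.
Proof.
apply: act_fixed => t Gt; rewrite rmorph_prod /= [RHS](reindex_inj (mulIg t)) /=.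
by apply: eq_big => [s|s _]; rewrite ?groupMr // actM.
Qed.

Section Transitivity.
Variables (k0 k k' : finFieldType) (pi0 : {rmorphism A -> k0}).
Variables (pi : {rmorphism B -> k}) (pi' : {rmorphism B -> k'}).
Hypothesis over : forall a, (pi (iota a) == 0) = (pi0 a == 0).
Hypothesis over' : forall a, (pi' (iota a) == 0) = (pi0 a == 0).

(** Otherwise avoidance gives an x in the kernel of pi' but outside all the conjugates of the kernel
    of pi. The product of its conjugates comes from A and lies in the kernel of pi', hence in that
    of pi, so one of the factors lies there too, against the choice of x. *)
Lemma kernels_conjugate :
  exists2 s, s \in G & forall x, (pi' x == 0) = (pi (act s x) == 0).
Proof.
pose psi s : {rmorphism B -> k} := pi \o act s.
(* One inclusion is enough: if x is outside the kernel of pi', then 1 - x^(|k'| - 1) is inside it,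
   and the kernel of [psi s] cannot contain both elements. *)
suff [s Gs le_ker] : exists2 s, s \in G & forall x, pi' x = 0 -> psi s x = 0.
  exists s => // x; apply/eqP/eqP => [/le_ker //|pi_sx].
  apply/eqP; apply: contraT => /finField_expf1 pi'x.
  have : psi s (1 - x ^+ #|k'|.-1) = 0.
    by apply: le_ker; rewrite rmorphB rmorph1 rmorphXn pi'x subrr.
  rewrite rmorphB rmorph1 rmorphXn /= pi_sx expr0n gtn_eqF ?finField_card_pred_gt0 //.
  by rewrite subr0 => /eqP; rewrite oner_eq0.
apply: contrapT => no_s.
have [s|x pi'x psi_x] := @kernel_avoidance _ _ _ pi' _ psi (enum G).
  rewrite mem_enum => Gs; apply: contrapT => no_x; apply: no_s; exists s => // x pi'x.
  by apply/eqP; apply: contraT => psi_x; case: no_x; exists x.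
have [a aE] := invariant_prod x.
have : pi (iota a) == 0.
  rewrite over -over' -aE rmorph_prod (bigD1 1%g) ?group1 //= act1 pi'x mul0r //.
rewrite -aE rmorph_prod => /eqP/eqP; apply/negP; apply/prodf_neq0 => s Gs.
by apply: psi_x; rewrite mem_enum.
Qed.

End Transitivity.

Variables (k0 k : finFieldType) (pi0 : {rmorphism A -> k0}) (pi : {rmorphism B -> k}).
Hypothesis over : forall a, (pi (iota a) == 0) = (pi0 a == 0).
Hypothesis pi_surj : forall y, exists x, pi x = y.
Hypothesis pi0_surj : forall y, exists x, pi0 x = y.
Local Notation Q := #|k0|.

Definition decomposes s := s \in G /\ forall x, (pi (act s x) == 0) = (pi x == 0).

Lemma same_pchar p : p \in [pchar k0] -> p \in [pchar k].
Proof.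
rewrite !inE => /andP[-> /eqP p0] /=.
by rewrite -(rmorph_nat pi) -(rmorph_nat iota) over rmorph_nat p0.
Qed.

Lemma pi_iota_frob a : pi (iota a) ^+ Q = pi (iota a).
Proof.
apply/eqP; rewrite -subr_eq0 -!rmorphXn -!rmorphB over rmorphB rmorphXn.
by rewrite expf_card subrr.
Qed.

(** The images of k0 already give Q roots of X^Q - X, so y cannot be a further one. *)
Lemma frob_fixed y : y ^+ Q = y -> exists a, y = pi (iota a).
Proof.
move=> yQ; apply: contrapT => no_a.
have /fin_all_exists[a aE] := pi0_surj.
pose r := y :: [seq pi (iota (a c)) | c <- enum k0].
pose q : {poly k} := 'X^Q - 'X.
have size_q : size q = Q.+1.
  by rewrite size_polyDl size_polyXn // size_polyN size_polyX ltnS finNzRing_gt1.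
have q_neq0 : q != 0 by rewrite -size_poly_eq0 size_q.
have : (size r < size q)%N.
  apply: max_poly_roots => //; last first.
    rewrite /= map_inj_uniq ?enum_uniq ?andbT.
      by apply/mapP => -[c _ yE]; apply: no_a; exists (a c).
    move=> c c' /eqP; rewrite -subr_eq0 -!rmorphB over rmorphB !aE subr_eq0.
    by move/eqP.
  apply/allP => x xr; rewrite /root /q !hornerE subr_eq0; apply/eqP.
  by move: xr; rewrite inE => /orP[/eqP-> //|/mapP[c _ ->]]; exact: pi_iota_frob.
by rewrite size_q /= size_map -cardE ltnn.
Qed.

Lemma decomposes_eq s x y : decomposes s -> pi x = pi y -> pi (act s x) = pi (act s y).
Proof.
case=> _ sE eq_xy; apply/eqP; rewrite -subr_eq0 -!rmorphB sE.
by rewrite rmorphB eq_xy subrr.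
Qed.

(** For s in G outside the decomposition group, [e s] is nonzero under pi but killed by s followed
    by pi. The product of all the [e s], raised to the power |k| - 1, keeps the second property and
    is 1 under pi. *)
Lemma approximation y : exists2 x, pi x = y &
  forall s, s \in G -> ~ decomposes s -> pi (act s x) = 0.
Proof.
have ex s : exists x, pi x != 0 /\ (s \in G -> ~ decomposes s -> pi (act s x) = 0).
  have [[Gs ND]|no] := pselect (s \in G /\ ~ decomposes s); last first.
    by exists 1; rewrite rmorph1 oner_eq0; split=> // ? ?; case: no.
  suff [x pix sx] : exists2 x, pi x != 0 & pi (act s x) = 0 by exists x.
  apply: contrapT => no_x; apply: ND; split=> // x; apply/eqP/eqP => [sx|pix].
    by apply/eqP; apply: contraT => pix; case: no_x; exists x.
  apply/eqP; apply: contraT => /finField_expf1 sx; case: no_x.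
  exists (1 - x ^+ #|k|.-1).
    rewrite rmorphB rmorph1 rmorphXn pix expr0n gtn_eqF ?finField_card_pred_gt0 //.
    by rewrite subr0 oner_eq0.
  by rewrite !(rmorphB, rmorph1, rmorphXn) sx subrr.
have /choice[e eE] := ex; pose e1 := \prod_s e s.
have pie1 : pi e1 != 0 by rewrite rmorph_prod; apply/prodf_neq0 => s _; case: (eE s).
have [a aE] := pi_surj y; exists (a * e1 ^+ #|k|.-1).
  by rewrite rmorphM rmorphXn finField_expf1 // aE mulr1.
move=> s Gs NDs; rewrite !(rmorphM, rmorphXn) /e1 !rmorph_prod (bigD1 s) //=.
have [_ ->] // := eE s.
by rewrite mul0r expr0n gtn_eqF ?mulr0 ?finField_card_pred_gt0.
Qed.

(** Let x lift a generator c of the units of k, with zero residue after every s outside the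
    decomposition group. The polynomial whose roots are the conjugates of x has coefficients in A,
    so its reduction is fixed by the Q-th power and has the root c^Q. This root is the residue of
    some conjugate of x by s, and being nonzero it forces s to decompose. *)
Lemma frobenius_exists :
  exists2 s, decomposes s & forall x, pi (act s x) = pi x ^+ Q.
Proof.
have [c c_neq0 c_gen] := finField_generator k.
have [x pix x_out] := approximation c.
pose q := \prod_(s in G) ('X - (act s x)%:P).
have act_q t : t \in G -> map_poly (act t) q = q.
  move=> Gt; rewrite rmorph_prod /= [RHS](reindex_inj (mulIg t)) /=.
  apply: eq_big => [s|s _]; rewrite ?groupMr //.
  by rewrite rmorphB /= map_polyX map_polyC /= actM.
pose q' := map_poly pi q.
have q'Q i : q'`_i ^+ Q = q'`_i.
  have [t Gt|a qa] := @act_fixed q`_i; first by rewrite -coef_map act_q.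
  by rewrite coef_map /= qa pi_iota_frob.
have q'E : q' = \prod_(s in G) ('X - (pi (act s x))%:P).
  by rewrite /q' rmorph_prod; apply: eq_bigr => s _; rewrite rmorphB /= map_polyX map_polyC.
clearbody q'; have [phi phiE] := card_frobenius_rmorphism same_pchar.
have : q'.[c ^+ Q] == 0.
  have {1}-> : q' = map_poly phi q' by apply/polyP => i; rewrite coef_map /= phiE q'Q.
  rewrite -phiE horner_map /= phiE q'E horner_prod (bigD1 1%g) ?group1 //=.
  rewrite act1 pix !hornerE subrr mul0r expr0n gtn_eqF // ltnW //.
  exact: finNzRing_gt1.
rewrite q'E horner_prod prodf_seq_eq0 => /hasP[s _ /andP[Gs]].
rewrite !hornerE subr_eq0 eq_sym => /eqP sx.
have Ds : decomposes s.
  apply: contrapT => /(x_out s Gs); rewrite sx => /eqP.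
  by rewrite expf_eq0 (negPf c_neq0) andbF.
(* Residues are 0 or powers of c, so the formula at x determines the action of s on all of them. *)
exists s => // b; have [b0|/c_gen[n bn]] := eqVneq (pi b) 0.
  rewrite b0 expr0n gtn_eqF; last by rewrite ltnW // finNzRing_gt1.
  by apply/eqP; rewrite Ds.2 b0.
have pib : pi b = pi (x ^+ n) by rewrite bn rmorphXn pix.
by rewrite (decomposes_eq Ds pib) !rmorphXn sx bn -!exprM mulnC.
Qed.

(** The coefficients of the polynomial q with roots c^(Q^i) are fixed by the Q-th power, so they
    lift to A. Then v lifts q(c) = 0, and as t preserves the kernel of pi, the residue of the
    conjugate of x by t is again a root of q. *)
Lemma decomposes_frob_power f t : #|k| = (Q ^ f)%N -> decomposes t ->
  exists i, forall x, pi (act t x) = pi x ^+ (Q ^ i).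
Proof.
move=> card_k Dt; have [c c_neq0 c_gen] := finField_generator k.
have [x pix] := pi_surj c.
have [phi phiE] := card_frobenius_rmorphism same_pchar.
pose h i : {poly k} := 'X - (c ^+ (Q ^ i))%:P; pose q := \prod_(i < f) h i.
have phi_h i : map_poly phi (h i) = h i.+1.
  by rewrite /h rmorphB /= map_polyX map_polyC /= phiE -exprM expnSr.
have phi_q : map_poly phi q = q.
  rewrite rmorph_prod (eq_bigr (fun i : 'I_f => h i.+1)) => [|i _]; last exact: phi_h.
  (* The factors are shifted cyclically because c^(Q^f) = c. *)
  rewrite {}/q; case: f card_k => [|f'] card_k; first by rewrite !big_ord0.
  rewrite big_ord_recr big_ord_recl mulrC; congr (_ * _) => /=.
  by rewrite /h -card_k expf_card expn0 expr1.
have /choice[a aE] i : exists a, q`_i = pi (iota a).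
  by apply: frob_fixed; rewrite -phiE -coef_map phi_q.
have f_gt0 : (0 < f)%N.
  by have := finNzRing_gt1 k; rewrite card_k; case: (f).
pose v := \sum_(i < size q) iota (a i) * x ^+ i.
have pi_act_v s : s \in G -> pi (act s v) = q.[pi (act s x)].
  move=> Gs; rewrite horner_coef !rmorph_sum; apply: eq_bigr => i _.
  by rewrite !(rmorphM, rmorphXn) act_iota // -aE.
have : q.[pi (act t x)] == 0.
  rewrite -pi_act_v ?Dt.1 // Dt.2 -(act1 v) pi_act_v ?group1 // act1 pix.
  rewrite horner_prod (bigD1 (Ordinal f_gt0)) //= /h expn0 expr1.
  by rewrite !hornerE subrr mul0r.
rewrite horner_prod prodf_seq_eq0 => /hasP[i _]; rewrite /= /h !hornerE subr_eq0.
move/eqP => tx; exists i => b; have [b0|/c_gen[n bn]] := eqVneq (pi b) 0.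
  rewrite b0 expr0n gtn_eqF; last by rewrite expn_gt0 ltnW // finNzRing_gt1.
  by apply/eqP; rewrite Dt.2 b0.
have pib : pi b = pi (x ^+ n) by rewrite bn rmorphXn pix.
by rewrite (decomposes_eq Dt pib) !rmorphXn tx bn -!exprM mulnC.
Qed.

Lemma frob_iter s : (forall x, pi (act s x) = pi x ^+ Q) ->
  forall t x, pi (act (s ^+ t)%g x) = pi x ^+ (Q ^ t).
Proof.
move=> sE; elim=> [|t IHt] x; first by rewrite expg0 act1 expn0 expr1.
by rewrite expgSr actM sE IHt -exprM expnSr.
Qed.

(** For the remainder r of t modulo f, all Q^f elements of k are roots of X^(Q^r) - X, whose degree
    is too small unless r = 0. *)
Lemma expf_card_dvdn f t : #|k| = (Q ^ f)%N ->
  (forall y : k, y ^+ (Q ^ t) = y) <-> (f %| t)%N.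
Proof.
move=> card_k; have Q_gt1 : (1 < Q)%N := finNzRing_gt1 k0.
have iter_f n (y : k) : y ^+ (Q ^ (f * n)) = y.
  by elim: n => [|n IHn]; rewrite ?muln0 ?expr1 // mulnS expnD exprM -card_k expf_card.
split=> [yE|/dvdnP[n ->] y]; last by rewrite mulnC iter_f.
have f_gt0 : (0 < f)%N by have := finNzRing_gt1 k; rewrite card_k; case: (f).
rewrite /dvdn; apply/eqP; set r := (t %% f)%N; have ltrf : (r < f)%N by rewrite ltn_mod.
have rE (y : k) : y ^+ (Q ^ r) = y.
  by rewrite -[RHS]yE (divn_eq t f) mulnC expnD exprM iter_f.
apply/eqP; rewrite -leqn0 leqNgt; apply/negP => r_gt0.
pose q : {poly k} := 'X^(Q ^ r) - 'X.
have Qr_gt1 : (1 < Q ^ r)%N by rewrite -(expn0 Q) ltn_exp2l.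
have size_q : size q = (Q ^ r).+1.
  by rewrite size_polyDl size_polyXn // size_polyN size_polyX ltnS.
have : (size (enum k) < size q)%N.
  apply: max_poly_roots; rewrite ?enum_uniq -?size_poly_eq0 ?size_q //.
  by apply/allP => y _; rewrite /root /q !hornerE rE subrr.
by rewrite size_q -cardE card_k ltnS leqNgt ltn_exp2l // ltrf.
Qed.

End Decomposition.

(** * Residue fields of number fields *)

Section MaximalIndependentFamily.
Local Open Scope ring_scope.
Variables (k : fieldType) (A : comNzRingType) (j : {rmorphism k -> A}).

Definition independent m (X : 'I_m -> A) :=
  forall c : {ffun 'I_m -> k}, \sum_i j (c i) * X i = 0 -> forall i, c i = 0.

(** A is only a ring, so that residue rings are covered before they are known to be fields. For m
    maximal, a relation between y and the family X has an invertible coefficient at y. *)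
Lemma basis_exists n : (forall X : 'I_n -> A, ~ independent X) ->
  exists m (X : 'I_m -> A), independent X /\
    forall y, exists! c : {ffun 'I_m -> k}, y = \sum_i j (c i) * X i.
Proof.
move=> no_ind.
have [m [[X indX] no_indS]] : exists m, (exists X : 'I_m -> A, independent X) /\
    forall X : 'I_m.+1 -> A, ~ independent X.
  elim: n no_ind => [|n IHn] no_ind.
    by case: (no_ind (fun=> 0)) => c _ [].
  have [[X indX]|no] := pselect (exists X : 'I_n -> A, independent X).
    by exists n; split=> //; exists X.
  by apply: IHn => X indX; apply: no; exists X.
exists m, X; split=> // y.
pose Y (i : 'I_m.+1) := oapp X y (unlift ord0 i).
have [c [c_sum [i0 ci0]]] : exists c : {ffun 'I_m.+1 -> k},
    \sum_i j (c i) * Y i = 0 /\ exists i, c i != 0.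
  apply: contrapT => no_c; apply: (no_indS Y) => c c_sum i.
  by apply/eqP; apply: contraT => ci; case: no_c; exists c; split=> //; exists i.
move: c_sum; rewrite big_ord_recl /Y unlift_none /=.
under eq_bigr do rewrite liftK /=.
move=> c_sum; have c0 : c ord0 != 0.
  apply: contraNneq ci0 => c00; move: c_sum; rewrite c00 rmorph0 mul0r add0r => c_sum.
  have cl := indX [ffun i => c (lift ord0 i)].
  case: (unliftP ord0 i0) => [i ->|->]; last by rewrite c00.
  apply/eqP; have := cl _ i; rewrite ffunE; apply.
  by under eq_bigr do rewrite ffunE.
pose c1 := [ffun i => - (c ord0)^-1 * c (lift ord0 i)].
have y1 : y = \sum_i j (c1 i) * X i.
  have jc : j ((c ord0)^-1) * j (c ord0) = 1 by rewrite -rmorphM mulVf // rmorph1.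
  rewrite -[LHS]mul1r -jc -mulrA -[_ * y]opprK (addr0_eq c_sum) mulrN mulr_sumr -sumrN.
  by apply: eq_bigr => i' _; rewrite ffunE rmorphM rmorphN mulrA !mulNr.
exists c1; split=> // c2 y2; apply/ffunP => i; apply/eqP; rewrite -subr_eq0; apply/eqP.
have -> : c1 i - c2 i = [ffun i => c1 i - c2 i] i by rewrite ffunE.
apply: indX; under eq_bigr do rewrite ffunE rmorphB mulrBl.
by rewrite sumrB -y1 -y2 subrr.
Qed.

End MaximalIndependentFamily.

(** * Integer relations in number fields *)

Section FiniteRank.
Local Open Scope ring_scope.

(** A form of finite dimension over the rationals that refers to no algebra structure, so that it
    serves K and its extension L alike. *)
Definition finite_rank (F : fieldType) := [pchar F] =i pred0 /\
  exists n, forall x : 'I_n -> F, exists c : 'I_n -> int,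
    (exists i, c i != 0) /\ \sum_i x i *~ c i = 0.

Lemma finite_rank_fieldExt (F : fieldExtType rat) : finite_rank F.
Proof.
split=> [p|]; first by rewrite pchar_lalg pchar_num.
exists (\dim {:F}).+1 => x.
pose X := [tuple x i | i < (\dim {:F}).+1].
have not_free : ~ free X.
  rewrite /free size_tuple => /eqP dimE.
  by have := dimvS (subvf <<X>>); rewrite dimE ltnn.
have [a a_sum [i0 ai0]] : exists2 a : 'I_(\dim {:F}).+1 -> rat,
    \sum_i a i *: X`_i = 0 & exists i, a i != 0.
  apply: contrapT => no_a; apply/not_free/vector.freeP => a a_sum i.
  by apply/eqP; apply: contraT => ai; case: no_a; exists a => //; exists i.
(* [c] clears the denominators of the rational relation, multiplying it by their product [D]. *)
pose c i := numq (a i) * \prod_(i' | i' != i) denq (a i').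
pose D := \prod_i denq (a i).
have cE i : (c i)%:~R = D%:~R * a i.
  rewrite /D (bigD1 i) // !rmorphM /=.
  by rewrite numqE [RHS]mulrC mulrA.
have D_neq0 : D != 0 by apply/prodf_neq0 => i _; rewrite denq_neq0.
exists c; split.
  by exists i0; rewrite -(intr_eq0 rat) cE mulf_neq0 // intr_eq0.
have ax_sum : \sum_i a i *: x i = 0.
  rewrite -[RHS]a_sum; apply: eq_bigr => i _.
  by rewrite -tnth_nth tnth_mktuple.
rewrite -[RHS](scaler0 _ (D%:~R : rat)) -[X in _ *: X]ax_sum.
by rewrite scaler_sumr; apply: eq_bigr => i _; rewrite scalerA -cE scaler_int.
Qed.

Lemma finite_rank_base (K : fieldExtType rat) (L : fieldExtType K) : finite_rank L.
Proof. exact: (finite_rank_fieldExt (baseFieldType L)). Qed.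

(** Descent: if l divides all the coefficients, the relation divided by l is still a relation in
    characteristic 0, with a smaller |c i0|. *)
Lemma finite_rank_coprime (F : fieldType) l : prime l -> finite_rank F ->
  exists n, forall x : 'I_n -> F, exists c : 'I_n -> int,
    (exists i, ~~ (l %| `|c i|)%N) /\ \sum_i x i *~ c i = 0.
Proof.
move=> pr_l [char0 [n ex_c]]; exists n => x; have [c [[i0 ci0] c_sum]] := ex_c x.
move: {2}(`|c i0|%N).+1 (ltnSn `|c i0|) => N.
elim: N c ci0 c_sum => // N IHN c ci0 c_sum ltN.
have [/existsP[i ndv]|] := boolP [exists i, ~~ (l %| `|c i|)%N].
  by exists c; split=> //; exists i.
rewrite negb_exists => /forallP all_dv.
pose c' i := (c i %/ l)%Z.
have cE i : c i = c' i * l.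
  by rewrite divzK // dvdzE; have := all_dv i; rewrite negbK.
apply: (IHN c').
- by apply: contraNneq ci0; rewrite (cE i0) => ->; rewrite mul0r.
- have : \sum_i x i *~ c i = (\sum_i x i *~ c' i) * l%:R.
    rewrite mulr_suml; apply: eq_bigr => i _; by rewrite cE mulrzA -pmulrn mulr_natr.
  rewrite c_sum => /esym/eqP; rewrite mulf_eq0 => /orP[/eqP //|].
  by have /pcharf0P -> := char0; rewrite gtn_eqF // prime_gt0.
- rewrite -ltnS; apply: leq_trans ltN; rewrite ltnS (cE i0) abszM absz_nat.
  rewrite ltn_Pmulr ?prime_gt1 // absz_gt0.
  by apply: contraNneq ci0; rewrite (cE i0) => ->; rewrite mul0r.
Qed.

End FiniteRank.

(** * Finiteness of the residue rings *)

Section ResidueField.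
Local Open Scope ring_scope.
Variables (F : fieldType) (p : prime_ideal F).
Local Notation OF := (integers F).
Local Notation Rp := (residue_field p).

Definition residue_pi : OF -> Rp := \pi_(Rp)%qT.

Fact residue_pi_zmod : zmod_morphism residue_pi.
Proof. by move=> x y; rewrite /residue_pi rmorphB. Qed.
Fact residue_pi_monoid : monoid_morphism residue_pi.
Proof. by split=> [|x y]; rewrite /residue_pi ?rmorph1 // rmorphM. Qed.
HB.instance Definition _ := GRing.isZmodMorphism.Build OF Rp residue_pi residue_pi_zmod.
HB.instance Definition _ := GRing.isMonoidMorphism.Build OF Rp residue_pi residue_pi_monoid.

Lemma residue_pi_repr y : residue_pi (generic_quotient.repr y) = y.
Proof. exact: reprK. Qed.

Lemma residue_pi_eq0 x : (residue_pi x == 0) = (x \in p).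
Proof.
rewrite -(rmorph0 residue_pi) -[x in RHS]subr0; apply/eqP/idP => [e|].
  by rewrite (Quotient.idealrBE (Idealr.clone OF (prime_ideal_pred p) _)); apply/eqP.
by rewrite (Quotient.idealrBE (Idealr.clone OF (prime_ideal_pred p) _)) => /eqP.
Qed.

Lemma residue_integral (x y : Rp) : x * y = 0 -> x = 0 \/ y = 0.
Proof.
rewrite -(residue_pi_repr x) -(residue_pi_repr y) -rmorphM => /eqP.
have [_ primeM _] := prime_idealP p.
by rewrite residue_pi_eq0 => /primeM/orP[]; rewrite -residue_pi_eq0 => /eqP; [left|right].
Qed.

Lemma integers_int (x : OF) (n : int) : integers_val (x *~ n) = integers_val x *~ n.
Proof. exact: (raddfMz (val : {additive OF -> F})). Qed.

(** An integral equation of a nonzero x in p can be divided by X until its constant coefficient is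
    nonzero; that coefficient is then a multiple of x, hence in p. *)
Lemma ex_int_in_prime : exists2 n : nat, (0 < n)%N & n%:R \in p.
Proof.
have [_ _ [x xp x_neq0]] := prime_idealP p.
have [c c_neq0 cp] : exists2 c : int, c != 0 & c%:~R \in p.
  have /asboolP[q mon_q qx] := integers_valP x.
  have {qx} : (map_poly intr q : {poly OF}).[x] == 0.
    rewrite -(inj_eq val_inj) rmorph0 -horner_map -map_poly_comp /=; move: qx.
    rewrite /root; congr (_.[_] == 0); apply: eq_map_poly => n.
    by symmetry; exact: (rmorph_int (val : {rmorphism OF -> F})).
  move: (monic_neq0 mon_q) => {mon_q}; elim/poly_ind: q => [|q c IHq]; first by rewrite eqxx.
  have [->|c_neq0] := eqVneq c 0; last first.
    move=> _; rewrite rmorphD rmorphM /= map_polyX map_polyC /= !hornerE => /eqP qx.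
    exists c => //; rewrite -[_%:~R]opprK rpredN -(addr0_eq qx) opprK.
    exact: idealMr.
  rewrite polyC0 addr0 mulf_eq0 polyX_eq0 orbF => q_neq0.
  rewrite rmorphM /= map_polyX !hornerE => /eqP qx; apply: IHq => //.
  apply: contraNT x_neq0 => qx_neq0; rewrite -(inj_eq val_inj) rmorph0.
  have /eqP := congr1 val qx; rewrite rmorphM rmorph0 mulf_eq0.
  by rewrite -(rmorph0 (val : {rmorphism OF -> F})) (inj_eq val_inj) (negPf qx_neq0).
exists `|c|%N; first by rewrite absz_gt0.
have -> : `|c|%N%:R = (Num.sg c * c)%:~R :> OF by rewrite -abszEsg.
by rewrite rmorphM /= idealMr.
Qed.

Lemma ex_prime_in_prime : exists2 l : nat, prime l & l%:R \in p.
Proof.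
have [n] := ex_int_in_prime; have [N] := ubnP n; elim: N n => // N IHN n ltnN n_gt0 np.
have [n_le1|n_gt1] := leqP n 1.
  by move: np; rewrite (_ : n = 1%N) ?idealr1 //; case: n n_gt0 n_le1 {ltnN} => [|[]].
have pr_l := pdiv_prime n_gt1.
have [lp|np'] := boolP ((pdiv n)%:R \in p); first by exists (pdiv n).
apply: (IHN (n %/ pdiv n)%N).
- by rewrite (leq_trans _ (ltnN : (n <= N)%N)) // ltn_Pdiv ?prime_gt1.
- by rewrite divn_gt0 ?prime_gt0 // dvdn_leq ?pdiv_dvd.
- move: np; rewrite -{1}(divnK (pdiv_dvd n)) natrM prime_idealrM.
  by rewrite (negPf np') orbF.
Qed.

Hypothesis rankF : finite_rank F.

(** Lifts of n elements of the residue ring satisfy an integer relation with some coefficient prime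
    to l. Its reduction is a nontrivial relation over F_l, so the residue ring has a finite basis
    over F_l. *)
Lemma residue_finite : finite_set [set: Rp].
Proof.
have [l pr_l lp] := ex_prime_in_prime.
have char_l : l \in [pchar Rp].
  by rewrite inE pr_l -(rmorph_nat residue_pi) residue_pi_eq0.
have [n ex_c] := finite_rank_coprime pr_l rankF.
pose j : {rmorphism 'F_l -> pPrimeCharType char_l} := in_alg _.
have [|m [X [_ X_span]]] := @basis_exists _ _ j n.
  move=> X indX.
  have [c [[i /negP ndvd] c_sum]] :=
    ex_c (fun i => integers_val (generic_quotient.repr (X i : Rp))).
  apply: ndvd; rewrite -[(_ %| _)%N]/(l %| c i)%Z (dvdz_pcharf (pchar_Fp pr_l)).
  have -> : (c i)%:~R = [ffun i => (c i)%:~R : 'F_l] i by rewrite ffunE.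
  apply/eqP/indX.
  transitivity (residue_pi (\sum_i generic_quotient.repr (X i : Rp) *~ c i)).
    rewrite raddf_sum; apply: eq_bigr => i' _.
    rewrite ffunE rmorph_int mulrzl raddfMz; congr (_ *~ _).
    exact/esym/residue_pi_repr.
  rewrite (_ : \sum_i _ = 0) ?rmorph0 //; apply: val_inj.
  rewrite rmorph0 -[RHS]c_sum (raddf_sum (val : {additive OF -> F})).
  by apply: eq_bigr => i' _; exact: integers_int.
pose h (c : {ffun 'I_m -> 'F_l}) : Rp := \sum_i j (c i) * X i.
apply: (@sub_finite_set _ _ (h @` setT)) => [y _|].
  by have [c [yE _]] := X_span y; exists c.
exact/finite_image/finite_finset.
Qed.

End ResidueField.

(** * Residue rings as finite fields *)

Section ResidueFiniteField.
Local Open Scope ring_scope.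
Variables (F : fieldType) (rankF : finite_rank F) (p : prime_ideal F).

(** The residue ring under a name that carries the rank hypothesis, so that the finite and field
    structures can be attached to the type. *)
Definition fin_residue_field of finite_rank F : Type := residue_field p.
Local Notation kp := (fin_residue_field rankF).
HB.instance Definition _ := GRing.ComNzRing.copy kp (residue_field p).

Let e : seq kp := enum_fset (fset_set [set: residue_field p]).

Fact mem_fin_residue_enum (x : kp) : x \in e.
Proof. by rewrite (in_fset_set (residue_finite p rankF)) inE. Qed.

Fact fin_residue_pickleK :
  pcancel (fun x : kp => index x e) (fun n => Some (nth 0 e n)).
Proof. by move=> x; rewrite nth_index ?mem_fin_residue_enum. Qed.
HB.instance Definition _ := Choice_isCountable.Build kp fin_residue_pickleK.

Fact fin_residue_enumP : Finite.axiom e.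
Proof.
by move=> x; rewrite count_uniq_mem ?fset_uniq // mem_fin_residue_enum.
Qed.
HB.instance Definition _ := isFinite.Build kp fin_residue_enumP.

Definition fin_residue_inv (x : kp) : kp :=
  if x == 0 then 0 else odflt 0 [pick y | y * x == 1].

(** Multiplication by x is injective in the integral residue ring, hence surjective by finiteness,
    so the search succeeds. *)
Fact fin_residue_mulVf (x : kp) : x != 0 -> fin_residue_inv x * x = 1.
Proof.
rewrite /fin_residue_inv => x_neq0; rewrite (negPf x_neq0); case: pickP => [y /eqP //|no_y].
have inj_x : injective (fun y : kp => y * x).
  move=> y z /eqP; rewrite -subr_eq0 -mulrBl => /eqP /residue_integral[/eqP|/eqP].
    by rewrite subr_eq0 => /eqP.
  by rewrite (negPf x_neq0).
by have := no_y (invF inj_x 1); rewrite (f_invF inj_x) eqxx.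
Qed.

Fact fin_residue_inv0 : fin_residue_inv 0 = 0.
Proof. by rewrite /fin_residue_inv eqxx. Qed.
HB.instance Definition _ := GRing.ComNzRing_isField.Build kp
  fin_residue_mulVf fin_residue_inv0.

Lemma card_fin_residue_field : #|{: kp}| = residue_card p.
Proof. by rewrite /residue_card cardT enumT unlock. Qed.

Definition fin_residue_pi : {rmorphism integers F -> kp} := @residue_pi F p.

End ResidueFiniteField.

(** * The residue degree *)

Section ResidueDegree.
Local Open Scope ring_scope.
Variables (K : fieldType) (L : fieldExtType K).

Fact integers_in_alg_zmod : zmod_morphism (@integers_in_alg K L).
Proof. by move=> x y; apply: val_inj; rewrite /= scalerBl. Qed.
Fact integers_in_alg_monoid : monoid_morphism (@integers_in_alg K L).
Proof.
split=> [|x y]; apply: val_inj; rewrite /= ?scale1r //.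
by rewrite -scalerAl mul1r scalerA.
Qed.
HB.instance Definition _ := GRing.isZmodMorphism.Build (integers K) (integers L)
  (@integers_in_alg K L) integers_in_alg_zmod.
HB.instance Definition _ := GRing.isMonoidMorphism.Build (integers K) (integers L)
  (@integers_in_alg K L) integers_in_alg_monoid.

Variables (rankK : finite_rank K) (rankL : finite_rank L).
Variables (p : prime_ideal L) (q : prime_ideal K).
Hypothesis pq : lies_over p q.
Local Notation kq := (fin_residue_field q rankK).
Local Notation kp := (fin_residue_field p rankL).

Lemma fin_residue_pi_eq0 (F : fieldType) (rankF : finite_rank F) (r : prime_ideal F) x :
  (fin_residue_pi rankF r x == 0) = (x \in r).
Proof. exact: residue_pi_eq0. Qed.

Lemma fin_residue_pi_surj (F : fieldType) (rankF : finite_rank F) (r : prime_ideal F) y :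
  exists x, fin_residue_pi rankF r x = y.
Proof. by exists (generic_quotient.repr (y : residue_field r)); exact: residue_pi_repr. Qed.

Lemma fin_residue_pi_over x :
  (fin_residue_pi rankL p (integers_in_alg L x) == 0) = (fin_residue_pi rankK q x == 0).
Proof. by rewrite !fin_residue_pi_eq0 pq. Qed.

Lemma residue_map_pi x :
  residue_map p (residue_pi q x) = residue_pi p (integers_in_alg L x).
Proof.
apply/eqP; rewrite -subr_eq0 -/(residue_pi p _) -!rmorphB /= residue_pi_eq0 pq.
by rewrite -residue_pi_eq0 rmorphB /= residue_pi_repr subrr.
Qed.

Fact residue_map_zmod : zmod_morphism (@residue_map K L p q).
Proof.
move=> x y; rewrite -(residue_pi_repr x) -(residue_pi_repr y) -rmorphB.
by rewrite !residue_map_pi !rmorphB.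
Qed.
Fact residue_map_monoid : monoid_morphism (@residue_map K L p q).
Proof.
split=> [|x y]; first by rewrite -(rmorph1 (@residue_pi K q)) residue_map_pi !rmorph1.
rewrite -(residue_pi_repr x) -(residue_pi_repr y) -rmorphM.
by rewrite !residue_map_pi !rmorphM.
Qed.

Definition fin_residue_map : {rmorphism kq -> kp} :=
  HB.pack (@residue_map K L p q : kq -> kp)
    (GRing.isZmodMorphism.Build kq kp _ residue_map_zmod)
    (GRing.isMonoidMorphism.Build kq kp _ residue_map_monoid).

Lemma residue_dim_card n : residue_dim p q n -> #|{: kp}| = (#|{: kq}| ^ n)%N.
Proof.
case=> b b_basis; have -> : (#|{: kq}| ^ n)%N = #|{: {ffun 'I_n -> kq}}|.
  by rewrite card_ffun card_ord.
pose h (c : {ffun 'I_n -> kq}) : kp := \sum_(i < n) residue_map p (c i) * b i.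
have surj_h y : exists c, h c == y.
  by have [c [yE _]] := b_basis y; exists c; apply/eqP.
pose h' y := xchoose (surj_h y).
have hK : cancel h' h by move=> y; apply/eqP/(xchooseP (surj_h y)).
have inj_h : injective h.
  move=> c c' eq_h; have [c0 [_ c0_uniq]] := b_basis (h c).
  by rewrite -(c0_uniq c) // -(c0_uniq c').
by apply/esym/(bij_eq_card (Bijective _ hK)) => c; apply: inj_h; rewrite hK.
Qed.

(** An independent family of |k_p| elements would have more combinations than k_p has elements. So a
    basis exists, and [residue_degree] does not fall back on its default. *)
Lemma card_residue_degree : #|{: kp}| = (#|{: kq}| ^ residue_degree p q)%N.
Proof.
apply: residue_dim_card; rewrite /residue_degree.
have [|n [b [_ b_basis]]] := @basis_exists _ _ fin_residue_map #|{: kp}|.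
  move=> X indX.
  pose h (c : {ffun 'I_#|{: kp}| -> kq}) : kp := \sum_i fin_residue_map (c i) * X i.
  have inj_h : injective h.
    move=> c c' eq_h; apply/ffunP => i; apply/eqP; rewrite -subr_eq0; apply/eqP.
    have -> : c i - c' i = [ffun i => c i - c' i] i by rewrite ffunE.
    apply: indX; under eq_bigr do rewrite ffunE rmorphB mulrBl.
    by rewrite sumrB -/(h c) -/(h c') eq_h subrr.
  have := leq_card h inj_h; rewrite card_ffun card_ord leqNgt.
  by rewrite ltn_expl // finNzRing_gt1.
have dim_n : residue_dim p q n by exists b; exact: b_basis.
by case: xgetP => [m _ //|no_n]; case: (no_n n).
Qed.

Lemma residue_degree_gt0 : (0 < residue_degree p q)%N.
Proof.
have := card_residue_degree; case: (residue_degree p q) => // card1.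
by have := finNzRing_gt1 kp; rewrite card1.
Qed.

End ResidueDegree.

(** * Primes in a Galois extension of number fields *)

Section GaloisPrimes.
Local Open Scope ring_scope.
Variables (K : fieldExtType rat) (L : splittingFieldType K).
Local Notation G := 'Gal({:L} / 1%AS)%G.
Hypothesis galL : galois 1%AS {:L}.
Let rankK : finite_rank K := finite_rank_fieldExt K.
Let rankL : finite_rank L := finite_rank_base L.

Fact gal_integers_zmod s : zmod_morphism (@gal_integers K L s).
Proof. by move=> x y; apply: val_inj; rewrite /= rmorphB. Qed.
Fact gal_integers_monoid s : monoid_morphism (@gal_integers K L s).
Proof. by split=> [|x y]; apply: val_inj; rewrite /= ?rmorph1 ?rmorphM. Qed.
HB.instance Definition _ s := GRing.isZmodMorphism.Build (integers L) (integers L)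
  (@gal_integers K L s) (gal_integers_zmod s).
HB.instance Definition _ s := GRing.isMonoidMorphism.Build (integers L) (integers L)
  (@gal_integers K L s) (gal_integers_monoid s).

Let act s : {rmorphism integers L -> integers L} := @gal_integers K L s.

Fact gal_integers1 x : act 1%g x = x.
Proof. by apply: val_inj; rewrite /= gal_id. Qed.

Fact gal_integersM s t x : act (s * t)%g x = act t (act s x).
Proof. by apply: val_inj; rewrite /= galM ?memvf. Qed.

Fact gal_integers_alg s a : s \in G -> act s (integers_in_alg L a) = integers_in_alg L a.
Proof.
move=> Gs; apply: val_inj; rewrite /= (fixed_gal _ Gs) ?subvf //.
by rewrite memvZ ?mem1v.
Qed.

Fact gal_integers_fixed b : {in G, forall s, act s b = b} ->
  exists a, b = integers_in_alg L a.
Proof.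
move=> fix_b.
have : integers_val b \in fixedField 'Gal({:L} / 1%AS)%g.
  apply/fixedFieldP; rewrite ?memvf // => s Gs.
  exact: (congr1 val (fix_b s Gs)).
rewrite (galois_fixedField galL) => /vlineP[c bE].
have /asboolP[r mon_r rb] := integers_valP b.
have int_c : c \in @integral_pred K.
  apply/asboolP; exists r => //; move: rb; rewrite bE.
  have -> : map_poly intr r = map_poly (in_alg L) (map_poly intr r).
    by rewrite -map_poly_comp; apply: eq_map_poly => n; rewrite [RHS]rmorph_int.
  by rewrite -in_algE fmorph_root.
by exists (Integers int_c); apply: val_inj; rewrite /= bE.
Qed.

Variable q : prime_ideal K.
Local Notation kq := (fin_residue_field q rankK).
Local Notation kp p := (fin_residue_field p rankL).
Local Notation pi0 := (fin_residue_pi rankK q).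
Local Notation pi p := (fin_residue_pi rankL p).

Lemma primes_over_conjugate (p p' : prime_ideal L) :
  lies_over p q -> lies_over p' q ->
  exists2 s, s \in G & forall x, (x \in p') = (act s x \in p).
Proof.
move=> pq p'q.
have [s Gs sE] := kernels_conjugate gal_integers1 gal_integersM gal_integers_fixed
  (fin_residue_pi_over rankK rankL pq) (fin_residue_pi_over rankK rankL p'q).
by exists s => // x; have := sE x; rewrite !fin_residue_pi_eq0.
Qed.

Lemma card_residue_le (p p' : prime_ideal L) : lies_over p q -> lies_over p' q ->
  (#|{: kp p'}| <= #|{: kp p}|)%N.
Proof.
move=> pq p'q; have [s _ sE] := primes_over_conjugate pq p'q.
have /choice[r rE] := @fin_residue_pi_surj _ rankL p'.
apply: (@leq_card _ _ (fun y => pi p (act s (r y)))) => y z /eqP.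
rewrite -subr_eq0 -!rmorphB fin_residue_pi_eq0 -sE -(fin_residue_pi_eq0 rankL).
by rewrite rmorphB subr_eq0 !rE => /eqP.
Qed.

Lemma residue_degree_eq (p p' : prime_ideal L) : lies_over p q -> lies_over p' q ->
  residue_degree p q = residue_degree p' q.
Proof.
move=> pq p'q; have Q_gt1 := finNzRing_gt1 kq.
apply: (expnI Q_gt1); rewrite -!(card_residue_degree rankK rankL) //.
by apply/eqP; rewrite eqn_leq !card_residue_le.
Qed.

Fact conj_prime_subproof (p : prime_ideal L) s :
  `[< nonzero_prime_ideal (fun x => act s x \in p) >].
Proof.
have [[p0 p1 pM] primeM [x xp x_neq0]] := prime_idealP p.
apply/asboolP; split.
- split; rewrite ?unfold_in /= ?rmorph0 ?rmorph1 //.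
  by move=> a u v; rewrite !unfold_in rmorphD rmorphM; exact: pM.
- by move=> u v; rewrite !unfold_in rmorphM; exact: primeM.
exists (act s^-1%g x); first by rewrite unfold_in -gal_integersM mulVg gal_integers1.
apply: contraNneq x_neq0 => /(congr1 (act s)).
by rewrite -gal_integersM mulVg gal_integers1 rmorph0 => ->.
Qed.

(** This is s^(-1) p. With this convention the elements of G giving the same prime form a left coset
    of the decomposition group. *)
Definition conj_prime p s : prime_ideal L := PrimeIdeal (conj_prime_subproof p s).

Lemma mem_conj_prime p s x : (x \in conj_prime p s) = (act s x \in p).
Proof. by []. Qed.

Lemma prime_ideal_inj (p p' : prime_ideal L) : (forall x, (x \in p) = (x \in p')) -> p = p'.
Proof. by move=> eq_p; apply: val_inj; apply/funext. Qed.

Variable p : prime_ideal L.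
Hypothesis pq : lies_over p q.
Local Notation D := (decomposition_group p).
Local Notation I := (inertia_group p).
Local Notation f := (residue_degree p q).
Let piE := fin_residue_pi_eq0 rankL.
Let over := fin_residue_pi_over rankK rankL pq.

Lemma decompositionP s :
  reflect (s \in G /\ forall x, (act s x \in p) = (x \in p)) (s \in D).
Proof. by rewrite inE; apply: (iffP andP) => -[Gs /asboolP]. Qed.

Lemma decomposesP s : reflect (decomposes G act (pi p) s) (s \in D).
Proof.
by apply: (iffP (decompositionP s)) => -[Gs sE]; split=> // x; have := sE x; rewrite !piE.
Qed.

Lemma inertiaP s :
  reflect (s \in G /\ forall x, pi p (act s x) = pi p x) (s \in I).
Proof.
rewrite inE; apply: (iffP andP) => [[/decompositionP[Gs _] /asboolP sE]|[Gs sE]].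
  by split=> // x; apply/eqP; rewrite -subr_eq0 -rmorphB piE; exact: sE.
have sD : s \in D by apply/decompositionP; split=> [//|x]; rewrite -!piE sE.
split; first exact: sD.
by apply/asboolP => x; rewrite -piE rmorphB -[gal_integers s x]/(act s x) sE subrr.
Qed.

Fact decomposition_group_set : group_set D.
Proof.
apply/group_setP; split=> [|s t /decompositionP[Gs sE] /decompositionP[Gt tE]].
  by apply/decompositionP; split=> [|x]; rewrite ?group1 ?gal_integers1.
by apply/decompositionP; split=> [|x]; rewrite ?groupM // gal_integersM tE sE.
Qed.
Canonical decomposition_Group := Group decomposition_group_set.

Fact inertia_group_set : group_set I.
Proof.
apply/group_setP; split=> [|s t /inertiaP[Gs sE] /inertiaP[Gt tE]].
  by apply/inertiaP; split=> [|x]; rewrite ?group1 ?gal_integers1.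
by apply/inertiaP; split=> [|x]; rewrite ?groupM // gal_integersM tE sE.
Qed.
Canonical inertia_Group := Group inertia_group_set.

Lemma inertia_sub : I \subset D.
Proof. by apply/fintype.subsetP => s; rewrite inE => /andP[]. Qed.

Lemma decomposition_sub : D \subset G.
Proof. by apply/fintype.subsetP => s; rewrite inE => /andP[]. Qed.

Lemma decomposition_norm : D \subset 'N(I)%g.
Proof.
apply/fintype.subsetP => t Dt; rewrite inE.
apply/fintype.subsetP => _ /imsetP[s /inertiaP[Gs sE] ->].
have Gt : t \in G by apply: (fintype.subsetP decomposition_sub).
apply/inertiaP; split=> [|x]; first by rewrite groupJ.
have /decomposesP Dt' := Dt.
rewrite conjgE !gal_integersM (decomposes_eq Dt' (sE _)).
by rewrite -gal_integersM mulVg gal_integers1.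
Qed.

Definition frobenius_like s := s \in D /\ forall x, pi p (act s x) = pi p x ^+ #|{: kq}|.

(** The coset of the s given by [frobenius_exists] is a Frobenius element, so the search in
    [frobenius] does not fall back on its default 1. *)
Lemma frobenius_likeP : frobenius_like (fingroup.repr (frobenius p q)).
Proof.
have [s /decomposesP Ds sE] := frobenius_exists gal_integers1 gal_integersM
  gal_integers_fixed over (@fin_residue_pi_surj _ rankL p).
rewrite /frobenius; case: pickP => [u /andP[Du /asboolP frob_u]|/(_ (coset I s))] /=.
  have ru : fingroup.repr u \in (u : {set _}) by exact: mem_repr_coset.
  split.
    case/morphimP: Du => d Nd Dd uE; move: ru; rewrite uE val_coset //.
    case/rcosetP => i; move=> Ii ->.
    by rewrite (groupM (G := decomposition_Group)) // (fintype.subsetP inertia_sub).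
  move=> x; apply/eqP; rewrite -subr_eq0 -rmorphXn -rmorphB piE.
  by rewrite card_fin_residue_field; exact: frob_u.
have Ns : s \in 'N(I)%g by apply: (fintype.subsetP decomposition_norm).
rewrite mem_quotient //= => /asboolP[] t x; rewrite val_coset // => /rcosetP[i Ii ->].
move: Ii => /inertiaP[_ iE].
rewrite -piE rmorphB rmorphXn -[gal_integers _ x]/(act _ x) gal_integersM.
by rewrite sE iE -card_fin_residue_field subrr.
Qed.

Lemma conj_prime_eq s t : s \in G -> t \in G ->
  (conj_prime p s == conj_prime p t) = (s \in t *: D)%g.
Proof.
move=> Gs Gt; rewrite mem_lcoset; apply/eqP/decompositionP => [eq_st|[_ sE]].
  split=> [|x]; first by rewrite groupM ?groupV.
  by rewrite gal_integersM -mem_conj_prime eq_st mem_conj_prime -gal_integersM mulVg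
    gal_integers1.
apply: prime_ideal_inj => x; rewrite !mem_conj_prime -(sE (act t x)).
by rewrite -gal_integersM mulKVg.
Qed.

(** By transitivity the primes over q form one orbit, and the fibres of [conj_prime p] on G are the
    left cosets of D. *)
Lemma card_primes_over : finite_set [set p' : prime_ideal L | lies_over p' q] /\
  (#|` fset_set [set p' : prime_ideal L | lies_over p' q]| * #|D| = #|G|)%N.
Proof.
pose X := [fset conj_prime p s | s in G]%fset.
have -> : [set p' : prime_ideal L | lies_over p' q]%classic = [set` X]%classic.
  apply/seteqP; split=> p' /= => [p'q|/imfsetP[s Gs ->] x]; last first.
    by rewrite mem_conj_prime gal_integers_alg // pq.
  have [s Gs sE] := primes_over_conjugate pq p'q.
  by apply/imfsetP; exists s => //; apply: prime_ideal_inj => x; rewrite sE.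
split; first exact: finite_fset.
rewrite set_fsetK.
pose h s : X := insubd [` in_imfset _ (conj_prime p) (group1 G)]%fset (conj_prime p s).
have hE s : s \in G -> val (h s) = conj_prime p s.
  by move=> Gs; rewrite val_insubd in_imfset.
rewrite -[in RHS]sum1_card (partition_big h predT) //= cardfE -sum_nat_const.
apply: eq_bigr => y _; have /imfsetP[t Gt yE] := valP y.
rewrite sum1_card -(card_lcoset D t); apply: eq_card => s.
rewrite [RHS]unfold_in; have [Gs|nGs] /= := boolP (s \in G).
  by rewrite -(inj_eq val_inj) hE // yE conj_prime_eq.
apply: contraNF nGs; rewrite mem_lcoset => /(fintype.subsetP decomposition_sub).
by rewrite groupMl ?groupV.
Qed.

Variable s : gal_of {:L}.
Hypothesis frob_s : frobenius_like s.

(** With Q = |k_q|, the power s^t acts on the residue field by y -> y^(Q^t), which is trivial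
    exactly when f divides t. *)
Lemma frobenius_order t : ((s ^+ t)%g \in I) = (f %| t)%N.
Proof.
have [Ds sE] := frob_s; have st := frob_iter gal_integers1 gal_integersM sE.
have card_k := card_residue_degree rankK rankL pq.
apply/inertiaP/idP => [[_ stE]|/(expf_card_dvdn t card_k) yE]; last first.
  split=> [|x]; last by rewrite st yE.
  by rewrite groupX // (fintype.subsetP decomposition_sub).
apply/(expf_card_dvdn t card_k) => y.
by have [x <-] := @fin_residue_pi_surj _ rankL p y; rewrite -st stE.
Qed.

(** D / I is generated by the coset of s, which has order f: an element of D acts on the residue
    field as some power of s, and so differs from it by inertia. *)
Lemma card_decomposition : #|D| = (f * #|I|)%N.
Proof.
have [Ds sE] := frob_s; have Ns := fintype.subsetP decomposition_norm s Ds.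
have card_k := card_residue_degree rankK rankL pq.
have sX t : (coset I s ^+ t == 1)%g = (f %| t)%N.
  have NsX : (s ^+ t)%g \in 'N(I)%g by rewrite groupX.
  rewrite -frobenius_order -morphX //=; apply/eqP/idP => [|/coset_id //].
  exact: coset_idr.
have order_s : #[coset I s]%g = f.
  by apply/eqP; rewrite eqn_dvd order_dvdn sX dvdnn /= -sX expg_order.
have DI : (D / I = <[coset I s]>)%g.
  apply/eqP; rewrite finset.eqEsubset cycle_subG mem_quotient // andbT.
  apply/fintype.subsetP => _ /morphimP[t Nt Dt ->].
  have /decomposesP Dt' := Dt.
  have [i tE] := decomposes_frob_power gal_integers1 gal_integers_alg over
    (@fin_residue_pi_surj _ rankL p) (@fin_residue_pi_surj _ rankK q) card_k Dt'.
  have NsX : (s ^+ i)%g \in 'N(I)%g by rewrite groupX.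
  apply/cycleP; exists i; rewrite -morphX //=; apply/rcoset_kercosetP => //.
  rewrite mem_rcoset; apply/inertiaP; split=> [|x].
    rewrite groupM ?groupV ?groupX ?(fintype.subsetP decomposition_sub) //.
  rewrite gal_integersM; set u := (s ^+ i)%g in NsX *.
  have /decomposesP Du : u^-1%g \in D by rewrite groupV groupX.
  rewrite (decomposes_eq Du (_ : _ = pi p (act u x))) => [|]; last first.
    by rewrite tE /u (frob_iter gal_integers1 gal_integersM sE).
  by rewrite -gal_integersM mulgV gal_integers1.
by rewrite -(Lagrange inertia_sub) mulnC -card_quotient ?decomposition_norm // DI -order_s.
Qed.

End GaloisPrimes.

(** * Cyclotomic coefficients *)

Section Cyclotomic.
Local Open Scope ring_scope.

(** Send w to a root z in C of its minimal polynomial. Rational polynomials vanishing at w vanish at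
    z, so evaluation at z does not depend on the polynomial chosen to represent an element of E. *)
Lemma simple_extension_embedding (C : numClosedFieldType) (E : fieldExtType rat) (w : E) :
  <<1; w>>%VS = fullv -> exists phi : {rmorphism E -> C}, True.
Proof.
move=> genE.
have /polyOver1P[m mE] := minPolyOver 1 w.
have ex_P a : exists r : {poly rat}, a == (map_poly (in_alg E) r).[w].
  have /Fadjoin_polyP[r0 /polyOver1P[r ->] ->] : a \in <<1; w>>%VS by rewrite genE memvf.
  by exists r.
have [z mz] : exists z : C, root (map_poly ratr m) z.
  by apply/closed_rootP; rewrite size_map_poly -(size_map_poly (in_alg E)) -mE size_minPoly.
have eval0 (r : {poly rat}) :
    (map_poly (in_alg E) r).[w] = 0 -> (map_poly (ratr : rat -> C) r).[z] = 0.
  move=> /rootP rw; apply/rootP; apply: root_dvdp mz.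
  rewrite dvdp_map -(dvdp_map (in_alg E)) -mE minPoly_dvdp //.
  by apply/polyOver1P; exists r.
pose P a := xchoose (ex_P a); have PE a : (map_poly (in_alg E) (P a)).[w] = a.
  by apply/esym/eqP/(xchooseP (ex_P a)).
pose phi a : C := (map_poly ratr (P a)).[z].
have phiB : zmod_morphism phi.
  move=> a b; apply/eqP; rewrite -subr_eq0 /phi.
  have := eval0 (P (a - b) - (P a - P b)); rewrite !rmorphB !hornerE !PE subrr.
  by move=> /(_ erefl) ->.
have phiM : monoid_morphism phi.
  split=> [|a b]; apply/eqP; rewrite -subr_eq0 /phi.
    have := eval0 (P 1 - 1); rewrite !rmorphB !rmorph1 !hornerE PE subrr.
    by move=> /(_ erefl) ->.
  have := eval0 (P (a * b) - P a * P b); rewrite !(rmorphB, rmorphM) !hornerE !PE subrr.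
  by move=> /(_ erefl) ->.
pose f : {rmorphism E -> C} := HB.pack phi (GRing.isZmodMorphism.Build _ _ _ phiB)
  (GRing.isMonoidMorphism.Build _ _ _ phiM).
by exists f.
Qed.

(** Automorphisms raise the generator w to powers, and such maps commute. *)
Lemma abelian_cyclotomic (E : splittingFieldType rat) (w : E) N :
  N.-primitive_root w -> <<1; w>>%VS = fullv -> abelian 'Gal({:E} / 1%AS)%g.
Proof.
move=> prw genE; apply/centsP => s Gs t Gt; apply/eqP/gal_eqP => a _.
have powE (u : gal_of {:E}) : exists i, u w = w ^+ i.
  have := prim_rootP prw (_ : u w ^+ N = 1).
  by rewrite -rmorphXn (prim_expr_order prw) rmorph1 => -[//|i ->]; exists i.
have [[i sw] [j tw]] := (powE s, powE t).
have /Fadjoin_polyP[r r1 ->] : a \in <<1; w>>%VS by rewrite genE memvf.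
have galE (u : gal_of {:E}) : u \in 'Gal({:E} / 1%AS)%g -> u r.[w] = r.[u w].
  by move=> Gu; rewrite -horner_map /= (fixedPoly_gal (sub1v _) Gu).
rewrite !galE ?groupM // !galM ?memvf // sw tw !rmorphXn /= sw tw.
by rewrite -!exprM mulnC.
Qed.

End Cyclotomic.

Section RootsOfUnityCoefficients.
Local Open Scope ring_scope.

(** The eigenvalues of M are N-th roots of unity, hence powers of [phi w]. *)
Lemma rev_char_poly_cyclotomic (C : numClosedFieldType) (E : fieldExtType rat)
    (phi : {rmorphism E -> C}) (w : E) N n (M : 'M[C]_n) :
  N.-primitive_root w -> M ^+ N = 1%:M ->
  exists h : {poly E}, rev_char_poly M = map_poly phi h.
Proof.
move=> prw MN; have prz : N.-primitive_root (phi w) by rewrite fmorph_primitive_root.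
have [s [sN -> _]] := finite_order_spectrum prz MN.
elim: s sN => [|x s IHs] sN; first by exists 1; rewrite big_nil rmorph1.
have [|h hE] := IHs; first by move=> y ys; apply: sN; rewrite inE ys orbT.
have [k xk] := prim_rootP prz (sN x (mem_head x s)).
exists ((1 - w ^+ k *: 'X) * h); rewrite big_cons hE xk.
by rewrite rmorphM rmorphB rmorph1 /= map_polyZ map_polyX rmorphXn.
Qed.

Lemma epolyX (V : choiceType) (R : comNzRingType) (p : V -> {poly R}) n :
  unitary p -> epoly p ^+ n = epoly (fun v => p v ^+ n).
Proof.
move=> p1; rewrite -{1}[n]subn0 -prodr_const_nat (epoly_prod _ (fun=> p1)).
by congr epoly; apply/funext => v; rewrite prodr_const_nat subn0.
Qed.

Lemma coef0X (R : comNzRingType) (p : {poly R}) n : p`_0 = 1 -> (p ^+ n)`_0 = 1.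
Proof. by move=> p1; rewrite -horner_coef0 horner_exp horner_coef0 p1 expr1n. Qed.

End RootsOfUnityCoefficients.

(** * The local identity at a prime of K *)

Section LocalData.
Local Open Scope ring_scope.
Variables (R : realType) (K : fieldExtType rat) (L : splittingFieldType K).
Local Notation G := 'Gal({:L} / 1%AS)%G.
Variables (J : finType) (d : J -> nat).
Variables (rho : forall j : J, mx_representation R[i] G (d j)).
Variables (P : prime_ideal K -> prime_ideal L) (z : R[i]).
Hypotheses (galL : galois 1%AS {:L}) (rho_sys : nontrivial_irr_system rho).
Hypotheses (P_over : forall q, lies_over (P q) q) (prz : #|G|.-primitive_root z).

Let s q := fingroup.repr (frobenius (P q) q).
Let frob_s q : frobenius_like q (P q) (s q) := frobenius_likeP galL (P_over q).
Let sIG q : inertia_Group (P q) \subset G :=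
  fintype.subset_trans (inertia_sub (P q)) (decomposition_sub (P q)).
Let Gs q : s q \in G := fintype.subsetP (decomposition_sub (P q)) _ (proj1 (frob_s q)).
Let nIs q : s q \in 'N(inertia_Group (P q))%g :=
  fintype.subsetP (decomposition_norm (P q)) _ (proj1 (frob_s q)).

Lemma frobenius_mx_order q j : frobenius_mx (rho j) P q ^+ #|G| = 1%:M.
Proof. exact: (fix_conj_order (sIG q) (Gs q) (nIs q)). Qed.

Definition number_of_primes q :=
  #|` fset_set [set p : prime_ideal L | lies_over p q]%classic|.

Lemma local_factorization q :
  (1 - 'X^(residue_degree (P q) q)) ^+ number_of_primes q =
  (1 - 'X) * \prod_j rev_char_poly (frobenius_mx (rho j) P q) ^+ d j :> {poly R[i]}.
Proof.
apply: (regular_factorization (sIG q) (Gs q) (nIs q) rho_sys _ _ prz) => [t|].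
  exact: (frobenius_order (P_over q) (frob_s q)).
have [_ <-] := card_primes_over galL (P_over q).
by rewrite (card_decomposition (P_over q) (frob_s q)) mulnA.
Qed.

End LocalData.

(** * Assembly of the Euler products *)

Theorem corollary3p6 (R : realType) (K : fieldExtType rat)
    (L : splittingFieldType K) (J : finType) (d : J -> nat)
    (rho : forall j : J, mx_representation R[i] 'Gal({:L} / 1%AS)%G (d j))
    (P : prime_ideal K -> prime_ideal L) :
  galois 1%AS {:L} ->
  nontrivial_irr_system rho ->
  (forall q : prime_ideal K, lies_over (P q) q) ->
  [/\ completed_AK R K (zeta_rel R L),
      completed_AK R K (zeta R K),
      forall j : J, completed_AK R K (artin (rho j) P)
    & zeta_rel R L = (zeta R K * \prod_(j : J) artin (rho j) P ^+ d j)%R].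
Proof.
move=> galL rho_sys P_over.
(* E is the cyclotomic field generated by a primitive |G|-th root of unity w; its image in the
   complex numbers contains all the coefficients. *)
have [E galE [_ _ [w [prw genE] _]]] :=
  integral_char.group_num_field_exists 'Gal({:L} / 1%AS)%G.
have [phi _] := simple_extension_embedding R[i] genE.
have abE := abelian_cyclotomic prw genE.
have prz : #|'Gal({:L} / 1%AS)%G|.-primitive_root%R (phi w).
  by rewrite fmorph_primitive_root.
pose f q := residue_degree (P q) q; pose g := number_of_primes L.
have zeta_relE : zeta_rel R L =
    ((epoly (fun v : sym_var K => (1 - 'X^(f v.1)) ^+ g v.1))^-1)%R.
  apply: zeta_relE => [q|q p pq|q].
  - exact: (residue_degree_gt0 (finite_rank_fieldExt K) (finite_rank_base L)).
  - exact: (residue_degree_eq galL).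
  - by have [finq _] := card_primes_over galL (P_over q).
pose h j q := rev_char_poly (frobenius_mx (rho j) P q).
have X1 : unitary (fun _ : sym_var K => 1 - 'X : {poly R[i]})%R.
  by move=> v; rewrite coefB coef1 coefX mulr0n subr0.
have h1 j : unitary (fun v : sym_var K => h j v.1).
  by move=> v; exact: coef0_rev_char_poly.
have f1 : unitary (fun v : sym_var K => (1 - 'X^(f v.1)) ^+ g v.1 : {poly R[i]})%R.
  move=> v; apply: coef0X; rewrite coefB coef1 coefXn eqxx ltn_eqF ?subr0 //.
  exact: (residue_degree_gt0 (finite_rank_fieldExt K) (finite_rank_base L)).
split.
- rewrite zeta_relE; apply: (completed_epolyV (phi := phi) galE abE
    (H := fun q => ((1 - 'X^(f q)) ^+ g q)%R)).
    by move=> q; exact: (f1 (q, 0%N)).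
  move=> q; exists ((1 - 'X^(f q)) ^+ g q)%R.
  by rewrite rmorphXn rmorphB rmorph1 /= map_polyXn.
- rewrite zetaE; apply: (completed_epolyV (phi := phi) galE abE (H := fun q => (1 - 'X)%R)).
    by move=> q; exact: (X1 (q, 0%N)).
  by move=> q; exists (1 - 'X)%R; rewrite rmorphB rmorph1 /= map_polyX.
- move=> j; rewrite artinE; apply: (completed_epolyV (phi := phi) galE abE (H := h j)).
    by move=> q; exact: coef0_rev_char_poly.
  move=> q; apply: (rev_char_poly_cyclotomic phi prw).
  exact: frobenius_mx_order.
(* All the Euler products are invertible, so the inverses can be cleared; the identity then holds
   variable by variable, as the local factorization. *)
rewrite zeta_relE zetaE; apply: (mulIr (epoly_unit f1)); rewrite mulVr ?epoly_unit //.
have -> : epoly (fun v : sym_var K => (1 - 'X^(f v.1)) ^+ g v.1)%R =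
    (epoly (fun v : sym_var K => 1 - 'X) *
     \prod_j epoly (fun v : sym_var K => h j v.1) ^+ d j)%R.
  under [in RHS]eq_bigr do rewrite epolyX //.
  rewrite epoly_prod => [|j v]; last exact/coef0X/h1.
  rewrite epolyM //; last by apply: unitary_prod => j v; exact/coef0X/h1.
  congr epoly; apply/funext => v.
  exact: (local_factorization galL rho_sys P_over prz).
rewrite mulrACA mulVr ?epoly_unit // mul1r -big_split /= big1 // => j _.
by rewrite artinE -exprMn mulVr ?expr1n //; exact: epoly_unit (h1 j).
Qed.
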